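(* Let $T=(V,E)$ be a locally finite tree with root $0$, let $\nu$ be a distribution of linear growth, and let $J=(J_e)_{e\in E}$ be i.i.d. random variables with law $\nu$ (so $J$ has law $\nu^{E}$). Then the following are equivalent: (i) The natural ground states are the only ground states, $\nu^{E}$-almost surely. (ii) $\inf\{\sum_{e\in\Pi}|J_e| : \Pi \text{ a cutset separating } 0 \text{ and } \infty\}=0$, $\nu^{E}$-almost surely. (iii) $\mathrm{MaxFlow}(0\to\infty,\langle |J_e|\rangle)=0$, $\nu^{E}$-almost surely. (iv) The simple random walk on $T$ is recurrent.
   Context: A distribution of linear growth is a probability measure $\nu$ on $\mathbb{R}$ for which there are $0<c<C<\infty$ with $c\,\epsilon\le\nu((-\epsilon,\epsilon))\le C\,\epsilon$ for all sufficiently small $\epsilon>0$ (in particular $\nu(\{0\})=0$). Ground states: for a finite $B\subset V$ let $\partial B$ be the set of edges with exactly one end in $B$. A configuration $\sigma\in\{-1,+1\}^V$ is a ground state for couplings $J=(J_{xy})_{(x,y)\in E}$ if $\sum_{(x,y)\in\partial B}J_{xy}\sigma_x\sigma_y\ge 0$ for every finite $B\subset V$. The natural ground states are the two configurations $\sigma$ with $J_{xy}\sigma_x\sigma_y\ge 0$ for every $(x,y)\in E$ (when all $J_e\neq 0$ these are exactly two, differing by a global sign). All edges are oriented away from the root $0$; write $x\to y$ if $(x,y)\in E$ with $x$ the endpoint closer to $0$. A cutset separating $0$ and $\infty$ is a set $\Pi\subset E$ such that every infinite non-self-intersecting path starting at $0$ contains an edge of $\Pi$. A flow (from $0$ to $\infty$)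 is a function $\theta:E\to[0,\infty)$ with $\sum_{x: x\to y}\theta((x,y))=\sum_{z: y\to z}\theta((y,z))$ for all $y\in V\setminus\{0\}$; its strength is $\sum_{x:0\to x}\theta((0,x))$. For capacities $\kappa_e\ge 0$, it is a flow with respect to $(\kappa_e)$ if $\theta(e)\le\kappa_e$ for all $e\in E$, and $\mathrm{MaxFlow}(0\to\infty,\langle\kappa_e\rangle)$ is the maximum of the strengths of all flows with respect to $(\kappa_e)$. *)

(* Defs.v *)
From HB Require Import structures.
From mathcomp Require Import all_boot all_order all_algebra finmap.
From mathcomp Require Import all_classical all_reals all_analysis.
Set Implicit Arguments.
Unset Strict Implicit.
Unset Printing Implicit Defensive.
Import Order.TTheory GRing.Theory Num.Theory.
Import numFieldNormedType.Exports.
Local Open Scope classical_set_scope.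
Local Open Scope ring_scope.

(* Local finiteness is built into the type of [nbr].  In [tree_acyclic],
   [ucycle] also accepts the closed walk [:: x; y] that runs along one edge
   and back, hence the bound 2. *)
Record rooted_tree (V : choiceType) := RootedTree {
  tree_root : V;
  nbr : V -> {fset V};
  nbr_sym : forall x y, (y \in nbr x) = (x \in nbr y);
  nbr_irrefl : forall x, x \notin nbr x;
  tree_connected : forall x y,
    exists2 p, path (fun u v => v \in nbr u) x p & last x p = y;
  tree_acyclic : forall p,
    ucycle (fun u v => v \in nbr u) p -> (size p <= 2)%N }.

Section Tree.
Variables (V : choiceType) (T : rooted_tree V).

Definition adj : rel V := fun x y => y \in nbr T x.

Definition walk_of_length (x y : V) (n : nat) : bool :=
  `[< exists p, [/\ path adj x p, last x p = y & size p = n] >].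

Lemma ex_walk_of_length (x y : V) : exists n, walk_of_length x y n.
Proof.
by have [p px py] := tree_connected T x y; exists (size p); apply/asboolP; exists p.
Qed.

Definition gdist (x y : V) : nat := ex_minn (ex_walk_of_length x y).

(* x -> y *)
Definition oriented (x y : V) : bool :=
  adj x y && (gdist (tree_root T) x < gdist (tree_root T) y)%N.

(* In a tree adjacent vertices are never equidistant from the root, so each
   unoriented edge is represented by exactly one oriented pair. *)
Definition edge := {xy : V * V | oriented xy.1 xy.2}.
Definition src (e : edge) : V := (val e).1.
Definition tgt (e : edge) : V := (val e).2.

Definition in_edges (y : V) : set edge := [set e | tgt e = y].
Definition out_edges (y : V) : set edge := [set e | src e = y].

Definition boundary (B : set V) : set edge :=
  [set e | (B (src e) /\ ~ B (tgt e)) \/ (~ B (src e) /\ B (tgt e))].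

Definition infinite_simple_path (p : nat -> V) : Prop :=
  [/\ p 0%N = tree_root T, forall n, adj (p n) (p n.+1) & injective p].

Definition joins (e : edge) (x y : V) : Prop :=
  (src e = x /\ tgt e = y) \/ (src e = y /\ tgt e = x).

Definition cutset (Pi : set edge) : Prop :=
  forall p, infinite_simple_path p ->
    exists n, exists2 e, Pi e & joins e (p n) (p n.+1).

End Tree.

Arguments in_edges {V} T y.
Arguments out_edges {V} T y.

Section Deterministic.
Variables (R : realType) (V : choiceType) (T : rooted_tree V).

(* The sums over edges below have finite index sets, by local finiteness;
   \sum_(_ \in _) would discard an infinite family of nonzero terms. *)

Definition configuration (s : V -> R) : Prop := forall x, s x = -1 \/ s x = 1.

Definition ground_states (J : edge T -> R) : set (V -> R) :=
  [set s | configuration s /\ forall B : set V, finite_set B ->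
    0 <= \sum_(e \in boundary B) J e * s (src e) * s (tgt e)].

Definition natural_ground_states (J : edge T -> R) : set (V -> R) :=
  [set s | configuration s /\ forall e, 0 <= J e * s (src e) * s (tgt e)].

Definition flow (theta : edge T -> R) : Prop :=
  (forall e, 0 <= theta e) /\
  forall y, y <> tree_root T ->
    \sum_(e \in in_edges T y) theta e = \sum_(e \in out_edges T y) theta e.

Definition strength (theta : edge T -> R) : R :=
  \sum_(e \in out_edges T (tree_root T)) theta e.

Definition flow_strengths (kappa : edge T -> R) : set R :=
  [set strength theta | theta in
    [set theta | flow theta /\ forall e, theta e <= kappa e]].

(* MaxFlow(0 -> oo, <kappa_e>) = m, as an attained maximum *)
Definition is_MaxFlow (kappa : edge T -> R) (m : R) : Prop :=
  flow_strengths kappa m /\ ubound (flow_strengths kappa) m.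

Definition cutset_weights (kappa : edge T -> R) : set (\bar R) :=
  [set (\esum_(e in Pi) (kappa e)%:E)%E | Pi in cutset (T := T)].

(* On the one-vertex tree the walk stays put. *)
Definition srw_prob (x y : V) : R :=
  if #|` nbr T x| == 0%N then (x == y)%:R
  else (adj T x y)%:R / #|` nbr T x|%:R.

End Deterministic.

Section Probability.
Variable R : realType.

Definition linear_growth (nu : probability (measurableTypeR R) R) : Prop :=
  exists c C : R, [/\ 0 < c, c < C &
    \forall eps \near (0 : R)^'+,
      ((c * eps)%:E <= nu (`]- eps, eps[%classic : set R)%R <= (C * eps)%:E)%E].

Definition iid_with_law (I : choiceType) d (Omega : measurableType d)
    (P : probability Omega R) (nu : probability (measurableTypeR R) R)
    (X : I -> {RV P >-> R}) : Prop :=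
  (forall i (A : set R), measurable A -> distribution P (X i) A = nu A) /\
  (forall (s : {fset I}) (A : I -> set R), (forall i, measurable (A i)) ->
     P (\bigcap_(i in [set` s]) (X i @^-1` A i)) =
     (\prod_(i <- s) P (X i @^-1` A i))%E).

Definition simple_random_walk (V : choiceType) (T : rooted_tree V) (x : V)
    d (Omega : measurableType d) (P : probability Omega R)
    (X : nat -> Omega -> V) : Prop :=
  (forall n y, measurable (X n @^-1` [set y])) /\
  (forall n (p : nat -> V),
     P [set w | forall i, (i <= n)%N -> X i w = p i] =
     ((p 0%N == x)%:R * \prod_(i < n) srw_prob R T (p i) (p i.+1))%:E).

(* Every vertex is recurrent: a simple random walk started there returns to it
   almost surely.  The property depends only on the law of the walk, hence the
   quantification over all its realizations. *)
Definition srw_recurrent (V : choiceType) (T : rooted_tree V) : Prop :=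
  forall (x : V) d (Omega : measurableType d) (P : probability Omega R)
    (X : nat -> Omega -> V),
    simple_random_walk T x P X ->
    {ae P, forall w, exists2 n, (0 < n)%N & X n w = x}.

End Probability.

(* Main.v *)
Require Import Defs.
From HB Require Import structures.
From mathcomp Require Import all_boot all_order all_algebra finmap.
From mathcomp Require Import all_classical all_reals all_analysis.
From mathcomp Require Import measurable_realfun.
From mathcomp Require Import ring lra zify.
Import Order.TTheory GRing.Theory Num.Theory.
Import numFieldNormedType.Exports.
Local Open Scope classical_set_scope.
Local Open Scope ring_scope.
Set Implicit Arguments.
Unset Strict Implicit.
Unset Printing Implicit Defensive.

(** For a vertex [y] let [F y] be the maximal flow from [y] to infinity inside the
subtree of [y], and [C y] the effective conductance of that subtree with unit
resistances. Summing over the children [z] of [y],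
  [F y = sum min(|J_yz|, F z)]   and   [C y = sum C z / (1 + C z)],
both being limits of the corresponding recursions over finitely many generations.

For fixed couplings, max-flow min-cut makes (ii) and (iii) equivalent to [F 0 = 0].
If [F] vanishes everywhere, an unsatisfied edge can be enclosed together with a
cutset of smaller weight, so every ground state is natural. If two siblings
[z1], [z2] with parent [v] satisfy [0 < |J_vz1| <= min(F z1, F z2, |J_vz2|)], the
configuration whose only unsatisfied edge is [(v, z1)] is a ground state.

The walk is recurrent iff [C 0 = 0]: a bounded harmonic function off one point is
flat when [C 0 = 0], and the voltage is a nonconstant one otherwise.

It remains to compare [F] and [C]. By independence and the lower bound on [nu],
[E min(|J|, 1, X) <= E X / (1 + b E X)], so [b E F <= C] for capped capacities, and
[C 0 = 0] forces [F 0 = 0]. The upper bound on [nu] gives, without independence,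
[E min(F y, t) >= t - K t^2 / C y]; hence [P(F y < t/2) <= 2 K t / C y]. If [C 0 > 0]
there are two siblings of positive conductance, and then the configuration above
exists with positive probability. *)

(** * Rooted trees *)

(** The almost sure statements are all compared with one deterministic number, [C 0]: when it
    vanishes they hold almost surely, and when it is positive an event of positive probability
    contradicts them. Two siblings are used because a finite set whose boundary contains the
    unsatisfied edge may lie on either side of it. A set containing [z1] pays for the flow out of
    [z1]; a set containing [v] has to pay without using [(v, z1)], and does so through [z2]. In the
    recurrent half, concavity alone gives only [E min(|J|, X) <= E X], without any decay. The gain
    comes from an event independent of [X]: [|J|] falls below a fixed fraction of [x = E X] with
    probability of order [x], which costs order [x^2], just as a resistance in series turns [x] into
    [x / (1 + b x)]. The cap at 1 keeps that threshold in the range where the growth of [nu] is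
    linear. In the transient half, an edge asked to carry a share [s] fails with probability at most
    [K s] and then loses at most [s]. The losses [K s^2] add up to [K] times the energy of the flow,
    which is least for the current flow. *)

Section TreeStructure.
Variables (V : choiceType) (T : rooted_tree V).
Local Notation r := (tree_root T).

Definition depth (x : V) : nat := gdist T r x.

Lemma adjC x y : adj T x y = adj T y x.
Proof. exact: nbr_sym. Qed.

Lemma adj_irrefl x : adj T x x = false.
Proof. by apply/negbTE/(nbr_irrefl T x). Qed.

Lemma depth_walk x : walk_of_length T r x (depth x).
Proof. by rewrite /depth /gdist; case: ex_minnP. Qed.

Lemma depth_min x n : walk_of_length T r x n -> (depth x <= n)%N.
Proof. by rewrite /depth /gdist; case: ex_minnP => m _ + /[dup] => /[apply]. Qed.

Lemma depth_root : depth r = 0%N.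
Proof. by apply/eqP; rewrite -leqn0; apply/depth_min/asboolP; exists [::]. Qed.

Lemma depth_eq0 x : depth x = 0%N -> x = r.
Proof.
move=> d0; have /asboolP[p [_ lp sp]] := depth_walk x.
by rewrite -lp (size0nil (etrans sp d0)).
Qed.

Lemma depth_adj x y : adj T x y -> (depth y <= (depth x).+1)%N.
Proof.
move=> xy; have /asboolP[p [pp lp sp]] := depth_walk x.
apply/depth_min/asboolP; exists (rcons p y).
by rewrite rcons_path last_rcons size_rcons pp lp sp.
Qed.

Lemma depth_pred x : x <> r -> exists2 y, adj T x y & (depth y < depth x)%N.
Proof.
move=> xr; have /asboolP[p [pp lp sp]] := depth_walk x.
elim/last_ind: p => [|p z _] in pp lp sp *; first by rewrite /= in lp; case: xr.
move: pp lp sp; rewrite rcons_path last_rcons size_rcons => /andP[pp lz] <- sp.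
exists (last r p); rewrite 1?adjC// -sp ltnS.
by apply/depth_min/asboolP; exists p.
Qed.

(** Depth strictly decreases along the walk, so a vertex at least as deep as [x] and different from
    it is never met. *)
Lemma path_to_root y x : (depth x <= depth y)%N -> x <> y ->
  exists p, [/\ path (adj T) x p, last x p = r & y \notin x :: p].
Proof.
move: {2}(depth x) (erefl (depth x)) => n.
elim: n x => [|n IH] x dx dxy xy.
  by exists [::]; rewrite (depth_eq0 dx)//= inE; split => //; apply/eqP => yr;
    apply: xy; rewrite yr (depth_eq0 dx).
have xr : x <> r by move=> xr; rewrite xr depth_root in dx.
have [z xz dz] := depth_pred xr.
have dzn : depth z = n.
  by apply/eqP; rewrite eqn_leq -ltnS -dx dz -ltnS -dx depth_adj// adjC.
have [||p [pp lp yp]] := IH z dzn; first by rewrite (leq_trans _ dxy)// ltnW.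
  by move=> zy; move: dxy; rewrite -zy leqNgt dz.
exists (z :: p); split => //=; first by rewrite xz.
by rewrite inE negb_or yp andbT; apply/eqP => yx; apply: xy.
Qed.

(* Two neighbours of [y] that are no deeper than [y] are joined by a walk
   avoiding [y], which would close up to a cycle through [y]. *)
Lemma shallow_nbr_uniq y x1 x2 : adj T y x1 -> adj T y x2 ->
  (depth x1 <= depth y)%N -> (depth x2 <= depth y)%N -> x1 = x2.
Proof.
move=> y1 y2 d1 d2; apply: contrapT => x12.
have ne x : adj T y x -> x <> y by move=> yx xy; rewrite xy adj_irrefl in yx.
have [p1 [pp1 lp1 yp1]] := path_to_root d1 (ne _ y1).
have [p2 [pp2 lp2 yp2]] := path_to_root d2 (ne _ y2).
have [q [pq lq yq]] : exists q, [/\ path (adj T) x1 q, last x1 q = x2 & y \notin x1 :: q].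
  (* To the root along [p1], then back along the reversed walk from [x2]. *)
  exists (p1 ++ rev (belast x2 p2)); split.
  - rewrite cat_path pp1 /= lp1 -lp2 rev_path.
    by apply: sub_path pp2 => a b /=; rewrite adjC.
  - rewrite last_cat; case: (p2) lp2 => [|a p]/=; last by rewrite rev_cons last_rcons.
    by rewrite lp1 => <-.
  - rewrite -cat_cons mem_cat (negbTE yp1)/= mem_rev.
    by apply: contra yp2 => /mem_belast; exact.
(* [tree_acyclic] speaks only of duplicate-free cycles, so loops are removed from the walk. *)
case: (shortenP pq) lq => q' pq' uq' sq' lq'.
have yq' : y \notin x1 :: q'.
  apply: contra yq; rewrite !inE => /orP[->//|/sq' ->]; exact: orbT.
have := @tree_acyclic _ T (y :: x1 :: q').
case: q' pq' uq' {sq'} lq' yq' => [|a q'] pq' uq' lq' yq'; first by case: x12.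
suff cyc : ucycle (fun u v => v \in nbr T u) (y :: x1 :: a :: q') by move/(_ cyc).
apply/andP; split; last by rewrite cons_uniq yq' uq'.
rewrite /= in pq' lq' *; move: y1 pq'; rewrite /adj => -> /= /andP[-> pq'] /=.
by rewrite rcons_path pq' lq' /= -/(adj _ _ _) adjC.
Qed.

Lemma depth_adj_neq x y : adj T x y -> depth x <> depth y.
Proof.
move=> xy dxy; case: (pselect (x = r)) => [xr|/depth_pred[z xz dz]].
  have yr : y = r by apply: depth_eq0; rewrite -dxy xr depth_root.
  by rewrite xr yr adj_irrefl in xy.
have zy : z = y by apply: (shallow_nbr_uniq xz xy); rewrite -?dxy// ltnW.
by rewrite zy dxy ltnn in dz.
Qed.

Lemma depth_adj_lt x y : adj T x y -> (depth x < depth y)%N -> depth y = (depth x).+1.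
Proof. by move=> xy xyd; apply/eqP; rewrite eqn_leq xyd depth_adj. Qed.

Definition children (y : V) : seq V := [seq z <- nbr T y | (depth y < depth z)%N].

(** For a non-root vertex the filtered list has exactly one element, by [shallow_nbr_uniq]; the
    default makes the root its own parent. *)
Definition parent (z : V) : V := head r [seq y <- nbr T z | (depth y < depth z)%N].

Lemma parent_root : parent r = r.
Proof.
by rewrite /parent; case: [seq y <- _ | _] (filter_all (fun y => depth y < depth r)%N
  (nbr T r)) => //= a s; rewrite depth_root.
Qed.

Lemma parentP z : z <> r -> adj T z (parent z) /\ (depth (parent z) < depth z)%N.
Proof.
move=> zr; suff: parent z \in [seq y <- nbr T z | (depth y < depth z)%N].
  by rewrite mem_filter => /andP[].
have [y zy dy] := depth_pred zr.
have : y \in [seq y <- nbr T z | (depth y < depth z)%N] by rewrite mem_filter dy.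
by rewrite /parent; case: [seq y <- _ | _] => //= a s _; rewrite mem_head.
Qed.

Lemma parentE y z : adj T y z -> (depth y < depth z)%N -> parent z = y.
Proof.
move=> yz dyz; have zr : z <> r by move=> zr; rewrite zr depth_root in dyz.
have [zp dp] := parentP zr.
by apply: (shallow_nbr_uniq zp _ (ltnW dp) (ltnW dyz)); rewrite adjC.
Qed.

Lemma depth_parent z : z <> r -> depth z = (depth (parent z)).+1.
Proof. by move=> /parentP[zp dp]; apply: depth_adj_lt; rewrite 1?adjC. Qed.

Lemma mem_children y z : (z \in children y) = (z != r) && (parent z == y).
Proof.
rewrite mem_filter; apply/andP/andP => [[dyz yz]|[/eqP zr /eqP <-]].
  rewrite (parentE yz dyz); split => //; apply/eqP => zr.
  by rewrite zr depth_root in dyz.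
by have [zp dp] := parentP zr; split => //; move: zp; rewrite adjC.
Qed.

Lemma children_parent z : z <> r -> z \in children (parent z).
Proof. by move=> zr; rewrite mem_children eqxx andbT; apply/eqP. Qed.

Lemma childrenP y z : z \in children y -> z <> r /\ parent z = y.
Proof. by rewrite mem_children => /andP[/eqP ? /eqP]. Qed.

Lemma children_adj y z : z \in children y -> adj T y z.
Proof. by rewrite mem_filter => /andP[]. Qed.

Lemma children_depth y z : z \in children y -> depth z = (depth y).+1.
Proof. by move=> /childrenP[/depth_parent -> ->]. Qed.

Lemma children_uniq y : uniq (children y).
Proof. exact/filter_uniq/fset_uniq. Qed.

Lemma nbr_root : perm_eq (nbr T r) (children r).
Proof.
apply: uniq_perm; rewrite ?children_uniq ?fset_uniq// => z.
rewrite mem_filter depth_root lt0n; case: eqP => //= /depth_eq0 ->.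
exact: adj_irrefl.
Qed.

Lemma adj_cases y z : adj T y z -> z \in children y \/ y \in children z.
Proof.
move=> yz; have := depth_adj_neq yz; rewrite !mem_filter -!/(adj _ _ _) yz adjC yz.
by rewrite !andbT => /eqP; rewrite neq_ltn => /orP.
Qed.

Lemma nbr_nonroot y : y <> r -> perm_eq (nbr T y) (parent y :: children y).
Proof.
move=> yr; have [yp dp] := parentP yr.
apply: uniq_perm => [||z]; rewrite ?fset_uniq//= ?children_uniq ?andbT.
  by rewrite mem_filter negb_and -leqNgt ltnW.
rewrite inE; apply/idP/orP => [yz|[/eqP ->//|/children_adj//]].
by have [|/childrenP[_ ->]] := adj_cases yz; [right|left].
Qed.

Lemma tree_ind (Q : V -> Prop) : Q r ->
  (forall z, z <> r -> Q (parent z) -> Q z) -> forall z, Q z.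
Proof.
move=> Qr Qs z; move: {2}(depth z) (erefl (depth z)) => n.
elim: n z => [|n IH] z dz; first by rewrite (depth_eq0 dz).
have zr : z <> r by move=> zr; rewrite zr depth_root in dz.
by apply: Qs => //; apply: IH; move: dz; rewrite (depth_parent zr) => -[].
Qed.

(** Recursion along the path from the root, with the depth as fuel. It yields the flow, the spin
    configuration and the voltage constructed below. *)
Lemma tree_rec A (a : A) (f : V -> A -> A) : exists g : V -> A,
  g r = a /\ forall z, z <> r -> g z = f z (g (parent z)).
Proof.
pose fix rec (n : nat) (z : V) {struct n} : A := if n is n'.+1 then f z (rec n' (parent z)) else a.
exists (fun z => rec (depth z) z); rewrite depth_root; split => // z zr.
by rewrite (depth_parent zr).
Qed.

Definition child_edge (e : edge T) : src e = parent (tgt e) /\ tgt e <> r.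
Proof.
have := valP e; rewrite /oriented => /andP[eadj ed].
by rewrite (parentE eadj ed); split => // tr; move: ed; rewrite -/(tgt e) tr -/(depth r)
  depth_root.
Qed.

Lemma tgt_inj : injective (@tgt V T).
Proof.
move=> e f ef; apply: val_inj; have [se _] := child_edge e; have [sf _] := child_edge f.
rewrite (surjective_pairing (val e)) (surjective_pairing (val f)).
by rewrite -/(src e) -/(src f) -/(tgt e) -/(tgt f) se sf ef.
Qed.

Definition edge_to (z : V) : option (edge T) := insub (parent z, z).

Lemma edge_toK e : edge_to (tgt e) = Some e.
Proof.
rewrite /edge_to; have [<- _] := child_edge e.
by rewrite /src /tgt -surjective_pairing valK.
Qed.

Lemma edge_toP z : z <> r -> exists e : edge T, tgt e = z.
Proof.
move=> zr; have [zp dp] := parentP zr.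
have o : oriented T (parent z, z).1 (parent z, z).2 by rewrite /oriented /= adjC zp.
by exists (exist _ (parent z, z) o).
Qed.

Lemma edge_to_root : edge_to r = None.
Proof. by rewrite /edge_to insubF// /oriented /= parent_root adj_irrefl. Qed.

(** A non-root vertex stands for the edge coming from its parent, so that edge functions become
    vertex functions; the root has no such edge and receives 0. *)
Definition on_vertex (M : nmodType) (g : edge T -> M) (z : V) : M :=
  oapp g 0 (edge_to z).

Lemma on_vertexE (M : nmodType) (g : edge T -> M) e : on_vertex g (tgt e) = g e.
Proof. by rewrite /on_vertex edge_toK. Qed.

Lemma on_vertex_root (M : nmodType) (g : edge T -> M) : on_vertex g r = 0.
Proof. by rewrite /on_vertex edge_to_root. Qed.

Lemma sum_out_edges (R : realType) (g : edge T -> R) y :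
  \sum_(e \in out_edges T y) g e = \sum_(z <- children y) on_vertex g z.
Proof.
rewrite [RHS]fsbig_seq ?children_uniq// (reindex_fsbig (@tgt V T) (out_edges T y)).
  by apply: eq_fsbigr => e _; rewrite on_vertexE.
split=> [e|e f _ _|z] /=; last 2 first.
- exact: tgt_inj.
- by move=> /childrenP[/edge_toP[e <-] py]; exists e => //=; rewrite /out_edges/=; have [-> _] := child_edge e.
by have [se tr] := child_edge e; rewrite /out_edges/= => <-; rewrite se; exact: children_parent.
Qed.

Lemma sum_in_edges (R : realType) (g : edge T -> R) y :
  \sum_(e \in in_edges T y) g e = on_vertex g y.
Proof.
case: (pselect (y = r)) => [->|/edge_toP[e <-]].
  rewrite on_vertex_root (_ : in_edges T r = set0) ?fsbig_set0//.
  by apply/seteqP; split => // e /= er; have [] := child_edge e.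
rewrite on_vertexE (_ : in_edges _ _ = [set e]) ?fsbig_set1//.
by apply/seteqP; split => [f|f ->//] /= /tgt_inj.
Qed.

Definition desc (y z : V) : Prop :=
  exists2 p, path (fun a b => b \in children a) y p & last y p = z.

Lemma desc_refl y : desc y y.
Proof. by exists [::]. Qed.

Lemma desc_iter y p : path (fun a b => b \in children a) y p ->
  iter (size p) parent (last y p) = y /\ depth (last y p) = (depth y + size p)%N.
Proof.
elim: p y => [|z p IH] y /=; first by rewrite addn0.
by move=> /andP[zy /IH[-> ->]]; rewrite (children_depth zy) addSnnS; have [_ ->] := childrenP zy.
Qed.

Lemma desc_depth y z : desc y z -> (depth y <= depth z)%N.
Proof. by move=> [p /desc_iter[_ dp] <-]; rewrite dp leq_addr. Qed.

Lemma desc_children y z w : z \in children y -> desc z w -> desc y w.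
Proof. by move=> zy [p pp lp]; exists (z :: p); rewrite //= zy. Qed.

Lemma desc_childrenr y z w : w \in children z -> desc y z -> desc y w.
Proof.
by move=> wz [p pp lp]; exists (rcons p w); rewrite ?rcons_path ?last_rcons// pp lp.
Qed.

(** Both descending paths have length [depth w - depth y - 1], and climbing that many parents from
    [w] ends at [z1] as well as at [z2]. *)
Lemma desc_children_uniq y z1 z2 w : z1 \in children y -> z2 \in children y ->
  desc z1 w -> desc z2 w -> z1 = z2.
Proof.
move=> z1y z2y [p /desc_iter[i1 d1] pw] [q /desc_iter[i2 d2] qw].
rewrite -i1 -i2 pw qw; congr (iter _ parent w).
by move: d1 d2; rewrite pw qw (children_depth z1y) (children_depth z2y) => ->; lia.
Qed.

Definition ray (y : V) (p : nat -> V) : Prop :=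
  p 0%N = y /\ forall n, p n.+1 \in children (p n).

Lemma ray_depth y p n : ray y p -> depth (p n) = (depth y + n)%N.
Proof.
move=> [p0 pS]; elim: n => [|n IH]; first by rewrite p0 addn0.
by rewrite (children_depth (pS n)) IH addnS.
Qed.

Lemma ray_inj y p : ray y p -> injective p.
Proof.
by move=> py i j /(congr1 depth); rewrite !(ray_depth _ py) => /eqP;
  rewrite eqn_add2l => /eqP.
Qed.

(** After a downward step, moving up would return to the vertex just left, which injectivity
    forbids. Hence cutsets need only be tested on descending rays. *)
Lemma ray_simple p : ray r p <-> infinite_simple_path T p.
Proof.
split=> [pr|[p0 padj pinj]].
  split; [by case: pr|by move=> n; apply: children_adj; case: pr|exact: ray_inj pr].
split => //; elim=> [|n IH].
  by have [//|/childrenP[]] := adj_cases (padj 0%N); rewrite p0.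
have [//|/childrenP[_ pp]] := adj_cases (padj n.+1).
by move: IH => /childrenP[_]; rewrite pp => /pinj; lia.
Qed.

Lemma joins_children (e : edge T) y z : z \in children y -> joins e y z -> tgt e = z.
Proof.
move=> zy [[_ //]|[sz ty]]; have [] := child_edge e; rewrite sz ty => zp yr.
by move: (children_depth zy) (depth_parent yr); rewrite zp => ->; lia.
Qed.

End TreeStructure.

(** * Maximal flow as a limit of a recursion over generations *)

Lemma cvg_sum_seq (R : realType) (I : choiceType) (s : seq I) (f : I -> nat -> R)
    (l : I -> R) : (forall i, f i @ \oo --> l i) ->
  (fun n => \sum_(i <- s) f i n) @ \oo --> \sum_(i <- s) l i.
Proof.
move=> fl; elim: s => [|i s IH].
  by under eq_fun do rewrite big_nil; rewrite big_nil; exact: cvg_cst.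
by under eq_fun do rewrite big_cons; rewrite big_cons; apply: cvgD.
Qed.

Lemma ler_sum_undup (R : numDomainType) (I : choiceType) (s : seq I) (f : I -> R) :
  (forall i, 0 <= f i) -> \sum_(i <- undup s) f i <= \sum_(i <- s) f i.
Proof.
move=> f0; elim: s => [|i s IH]; first by rewrite big_nil.
rewrite /= big_cons; case: ifP => _; last by rewrite big_cons lerD2l.
by rewrite (le_trans IH)// lerDr.
Qed.

Section Esum.
Variables (R : realType) (I : choiceType).

Lemma esum_subset (A B : set I) (f : I -> \bar R) : A `<=` B ->
  (forall i, 0 <= f i)%E -> (\esum_(i in A) f i <= \esum_(i in B) f i)%E.
Proof.
move=> AB f0; rewrite [leLHS]esum_mkcond [leRHS]esum_mkcond; apply: le_esum => i _.
case: ifPn => [/[!inE] /AB Bi|_]; first by rewrite ifT// inE.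
by case: ifP.
Qed.

Lemma esum_seq_le (s : seq I) (f : I -> R) : (forall i, 0 <= f i) ->
  (\esum_(i in [set` s]) (f i)%:E <= (\sum_(i <- s) f i)%:E)%E.
Proof.
move=> f0; rewrite esum_fset ?lee_fin//; last by move=> i _; rewrite lee_fin.
rewrite fsumEFin// lee_fin (_ : [set` s] = [set` undup s]).
  by rewrite -fsbig_seq ?undup_uniq// ler_sum_undup.
by apply/seteqP; split => i /=; rewrite mem_undup.
Qed.

End Esum.

Section TreeRecursion.
Variables (R : realType) (V : choiceType) (T : rooted_tree V).
Variables (phi : V -> R -> R) (u0 : V -> R).
Local Notation children := (children T).

(** Common frame for flow and conductance: [phi z t] is what the edge to [z] transmits of an amount
    [t] available below [z]. The start [u0] is an overestimate, so the iterates decrease. *)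
Fixpoint trec (n : nat) (y : V) : R :=
  if n is n'.+1 then \sum_(z <- children y) phi z (trec n' z) else u0 y.

Definition tlim (y : V) : R := limn (trec ^~ y).

Hypothesis phi_ge0 : forall z (t : R), 0 <= t -> 0 <= phi z t.
Hypothesis phi_mono : forall z (s t : R), 0 <= s -> s <= t -> phi z s <= phi z t.
Hypothesis u0_ge0 : forall y, 0 <= u0 y.
Hypothesis u0_ge : forall y, \sum_(z <- children y) phi z (u0 z) <= u0 y.

Lemma trec_ge0 n y : 0 <= trec n y.
Proof. by elim: n y => [//|n IH] y /=; apply: sumr_ge0 => z _; exact: phi_ge0. Qed.

Lemma trecS_le n y : trec n.+1 y <= trec n y.
Proof.
elim: n y => [|n IH] y; first exact: u0_ge.
by apply: ler_sum => z _; apply: phi_mono; [exact: (trec_ge0 n.+1)|exact: IH].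
Qed.

Lemma trec_noninc y : nonincreasing_seq (trec ^~ y).
Proof. by apply/nonincreasing_seqP => n; exact: trecS_le. Qed.

Lemma is_cvg_trec y : cvgn (trec ^~ y).
Proof.
apply: nonincreasing_is_cvgn; first exact: trec_noninc.
by exists 0 => _ [n _ <-]; exact: trec_ge0.
Qed.

Lemma tlim_ge0 y : 0 <= tlim y.
Proof. by apply: limr_ge; [exact: is_cvg_trec|apply: nearW => n; exact: trec_ge0]. Qed.

Lemma tlim_le n y : tlim y <= trec n y.
Proof. exact: nonincreasing_cvgn_ge (@trec_noninc y) (@is_cvg_trec y) n. Qed.

Lemma tlim_lt y c : tlim y < c -> exists n, trec n y < c.
Proof.
move=> yc; apply: contrapT => /forallNP cn; move: yc; apply/negP; rewrite -leNgt.
apply: limr_ge; first exact: is_cvg_trec.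
by apply: nearW => n; have /negP := cn n; rewrite -leNgt.
Qed.

Hypothesis phi_cvg : forall z (u : nat -> R) (l : R), (forall n, 0 <= u n) -> 0 <= l ->
  u @ \oo --> l -> (fun n => phi z (u n)) @ \oo --> phi z l.

Lemma tlimE y : tlim y = \sum_(z <- children y) phi z (tlim z).
Proof.
have cS : (fun n => trec n.+1 y) @ \oo --> tlim y.
  by rewrite (cvg_shiftS (trec ^~ y)); exact: is_cvg_trec.
apply: (cvg_unique _ cS) => //=; apply: cvg_sum_seq => z.
by apply: phi_cvg; [move=> n; exact: trec_ge0|exact: tlim_ge0|exact: is_cvg_trec].
Qed.

End TreeRecursion.

Section MaxFlow.
Variables (R : realType) (V : choiceType) (T : rooted_tree V).
Local Notation children := (children T).
Local Notation r := (tree_root T).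

(** The maximal flow from [y] to the vertices [n + 1] generations below it. *)
Definition maxflow_n (k : V -> R) := trec T (fun z t => Num.min (k z) t) (fun y => \sum_(z <- children y) k z).
Definition maxflow (k : V -> R) := tlim T (fun z t => Num.min (k z) t) (fun y => \sum_(z <- children y) k z).

Variable k : V -> R.
Hypothesis k_ge0 : forall z, 0 <= k z.

Local Ltac maxflow_side := move=> *; rewrite ?le_min ?k_ge0 ?ge_min ?lexx ?sumr_ge0//=.

Lemma maxflow_n_ge0 n y : 0 <= maxflow_n k n y.
Proof. by apply: trec_ge0; maxflow_side. Qed.

Let min_mono (z : V) (s t : R) : 0 <= s -> s <= t -> Num.min (k z) s <= Num.min (k z) t.
Proof. by move=> _ st; rewrite le_min !ge_min lexx st orbT. Qed.

Let sum_ge y : \sum_(z <- children y) Num.min (k z) (\sum_(w <- children z) k w) <= \sum_(z <- children y) k z.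
Proof. by apply: ler_sum => z _; rewrite ge_min lexx. Qed.

Lemma maxflow_ge0 y : 0 <= maxflow k y.
Proof. by apply: tlim_ge0 => //; maxflow_side. Qed.

Lemma maxflow_le n y : maxflow k y <= maxflow_n k n y.
Proof. by apply: tlim_le => //; maxflow_side. Qed.

Lemma maxflow_lt y c : maxflow k y < c -> exists n, maxflow_n k n y < c.
Proof. by apply: tlim_lt => //; maxflow_side. Qed.

Lemma maxflow_n_noninc y : nonincreasing_seq (fun n => maxflow_n k n y).
Proof. by apply: trec_noninc => //; maxflow_side. Qed.

Lemma cvg_maxflow_n y : (fun n => maxflow_n k n y) @ \oo --> maxflow k y.
Proof. by apply: is_cvg_trec => //; maxflow_side. Qed.

Lemma maxflowE y : maxflow k y = \sum_(z <- children y) Num.min (k z) (maxflow k z).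
Proof.
apply: tlimE => //; try by maxflow_side.
move=> z u l _ _ ul; rewrite minr_absE; under eq_fun do rewrite minr_absE.
by apply: cvgM; [apply: cvgB; [apply: cvgD => //; exact: cvg_cst|
  apply: cvg_norm; apply: cvgB => //; exact: cvg_cst]|exact: cvg_cst].
Qed.

Definition cut_weight (Pi : set V) (y : V) : \bar R :=
  (\esum_(w in [set w | Pi w /\ desc T y w /\ w <> y]) (k w)%:E)%E.

(** The subtrees of distinct children are disjoint, so each vertex of [Pi] strictly below [y] is
    counted at most once on the left. *)
Lemma cut_weight_ge Pi y :
  (\sum_(z <- children y) \esum_(w in [set w | Pi w /\ desc T z w]) (k w)%:E
    <= cut_weight Pi y)%E.
Proof.
rewrite /cut_weight [leRHS]esum_mkcond.
under eq_bigr do rewrite esum_mkcond.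
rewrite -esum_sum => [|w z _ _]; last by case: ifP; rewrite lee_fin.
apply: le_esum => w _; case: (boolP (has (fun z => `[< desc T z w >]) (children y))).
  move=> /hasP[z zy /asboolP zw].
  rewrite (bigD1_seq z) ?children_uniq//= big1_seq ?adde0.
    case: ifPn => [/[!inE] -[Pw _]|_]; last by case: ifP; rewrite lee_fin.
    rewrite ifT// inE; split => //; split; first exact: desc_children zy zw.
    by move=> wy; have := desc_depth zw; rewrite wy (children_depth zy) ltnn.
  move=> z' /andP[z'z z'y]; case: ifPn => // /[!inE] -[_ z'w].
  by rewrite (desc_children_uniq zy z'y zw z'w) eqxx in z'z.
move=> /hasPn nz; rewrite big1_seq; first by case: ifP; rewrite ?lee_fin.
by move=> z /andP[_ /nz /asboolPn zw]; case: ifPn => // /[!inE] -[_ /zw].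
Qed.

(* Since [maxflow k y] is a sum over the children, one of them inherits the
   strict inequality through an edge outside [Pi]. *)
Lemma avoid_cut Pi y : (cut_weight Pi y < (maxflow k y)%:E)%E ->
  exists p, ray T y p /\ forall n, ~ Pi (p n.+1).
Proof.
pose good z := `[< (cut_weight Pi z < (maxflow k z)%:E)%E >].
move=> /asboolP gy; have step z : good z -> exists w, [/\ w \in children z, ~ Pi w & good w].
  move=> /asboolP; rewrite ltNge => /negP gz; apply: contrapT => /forallNP bad.
  apply: gz; rewrite maxflowE -sumEFin; apply: le_trans (cut_weight_ge Pi z).
  rewrite big_seq [leRHS]big_seq; apply: lee_sum => w wz.
  case: (pselect (Pi w)) => Pw.
    apply: (@le_trans _ _ (k w)%:E); first by rewrite lee_fin ge_min lexx.
    rewrite -[leLHS](@esum_set1 _ _ w (fun w => (k w)%:E)) ?lee_fin//.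
    apply: esum_subset => [_ -> |i]; last by rewrite lee_fin.
    by split => //; exact: desc_refl.
  have fw : ((maxflow k w)%:E <= cut_weight Pi w)%E.
    by rewrite leNgt; apply/negP => gw; apply: (bad w); split => //; exact/asboolP.
   rewrite (@le_trans _ _ (maxflow k w)%:E)//.
    by rewrite lee_fin ge_min lexx orbT.
  apply: (le_trans fw); apply: esum_subset => [i [? []]//|i]; by rewrite lee_fin.
have [f fP] : {f : V -> V & forall z, good z -> [/\ f z \in children z, ~ Pi (f z) & good (f z)]}.
  apply: (@choice _ _ (fun z w => good z -> [/\ w \in children z, ~ Pi w & good w])) => z.
  by case: (pselect (good z)) => [/step[w ?]|ngz]; [exists w|exists z].
have gn n : good (iter n f y) by elim: n => [//|n /fP[]].
exists (fun n => iter n f y); by split=> [|n]; [split => // n|]; have [] := fP _ (gn n).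
Qed.

(** A finite cut read off the recursion: an edge is cut as soon as its capacity is at most the flow
    available beyond it, that is, where the minimum is attained by the capacity. [near_side] is the
    part of the subtree still reachable from [y], and [min_cut] lists the lower endpoints of the cut
    edges. *)
Fixpoint near_side n y : seq V := y ::
  (if n is n'.+1 then
     flatten [seq if k z <= maxflow_n k n' z then [::] else near_side n' z | z <- children y]
   else [::]).

Fixpoint min_cut n y : seq V :=
  if n is n'.+1 then
    flatten [seq if k z <= maxflow_n k n' z then [:: z] else min_cut n' z | z <- children y]
  else children y.

Lemma near_side_self n y : y \in near_side n y.
Proof. by case: n => [|n]; exact: mem_head. Qed.

Lemma near_side_desc n y w : w \in near_side n y -> desc T y w.
Proof.
elim: n y => [|n IH] y /=; rewrite !inE; first by move=> /eqP ->; exact: desc_refl.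
move=> /predU1P[->|/flatten_mapP[z zy]]; first exact: desc_refl.
by case: ifP => // _ /IH; exact: desc_children.
Qed.

Lemma near_side_parent n y w : w \in near_side n y -> w = y \/ parent T w \in near_side n y.
Proof.
elim: n y => [|n IH] y /=; rewrite !inE; first by move=> /eqP; left.
move=> /predU1P[|/flatten_mapP[z zy]]; first by left.
case: ifP => // kz wz; have [->|pw] := IH _ wz; right.
  by have [_ ->] := childrenP zy; rewrite eqxx.
by apply/orP; right; apply/flatten_mapP; exists z => //; rewrite kz.
Qed.

Lemma near_side_out n y x w : x \in near_side n y -> w \in children x ->
  w \notin near_side n y -> w \in min_cut n y.
Proof.
elim: n y => [|n IH] y /=; rewrite !inE; first by move=> /eqP ->.
move=> /predU1P[-> wy|/flatten_mapP[z zy + wx]].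
  rewrite negb_or => /andP[_ nw]; apply/flatten_mapP; exists w => //.
  case: ifPn => [|kw]; first by rewrite inE.
  exfalso; move/negP: nw; apply; apply/flatten_mapP; exists w => //.
  by rewrite (negbTE kw) near_side_self.
case: ifPn => // kz xz; rewrite negb_or => /andP[_ nw].
apply/flatten_mapP; exists z => //; rewrite (negbTE kz); apply: (IH _ xz wx).
by apply: contra nw => wz; apply/flatten_mapP; exists z => //; rewrite (negbTE kz).
Qed.

Lemma min_cut_weight n y : \sum_(w <- min_cut n y) k w <= maxflow_n k n y.
Proof.
elim: n y => [|n IH] y; first exact: lexx.
rewrite /= big_flatten big_map; apply: ler_sum => z _.
case: (leP (k z) (maxflow_n k n z)) => _; [by rewrite big_cons big_nil /= addr0|exact: IH].
Qed.

Lemma min_cut_ray n y p : ray T y p -> exists m, p m.+1 \in min_cut n y.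
Proof.
elim: n y p => [|n IH] y p [p0 pS] /=; first by exists 0%N; rewrite -p0.
have [kp|kp] := boolP (k (p 1%N) <= maxflow_n k n (p 1%N)).
  exists 0%N; apply/flatten_mapP; exists (p 1%N); first by rewrite -p0.
  by rewrite kp inE.
have [|m pm] := IH (p 1%N) (fun n => p n.+1); first by split.
exists m.+1; apply/flatten_mapP; exists (p 1%N); first by rewrite -p0.
by rewrite (negbTE kp).
Qed.

Lemma maxflow_gt0_all : (forall z, z <> r -> 0 < k z) -> maxflow k r = 0 ->
  forall y, maxflow k y = 0.
Proof.
move=> k0 fr; apply: (tree_ind fr) => z zr fp.
have := maxflowE (parent T z); rewrite fp => /esym/eqP.
rewrite psumr_eq0 => [|w _]; last by rewrite le_min k_ge0 maxflow_ge0.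
move=> /allP/(_ _ (children_parent zr))/= /eqP; rewrite minEle; case: ifP => // _ kz.
by have := k0 _ zr; rewrite kz ltxx.
Qed.

End MaxFlow.

(** * Cutsets, flows and ground states for fixed couplings *)

Section Deterministic.
Variables (R : realType) (V : choiceType) (T : rooted_tree V).
Local Notation children := (children T).
Local Notation r := (tree_root T).
Local Notation parent := (parent T).

Lemma on_vertex_ge0 (g : edge T -> R) : (forall e, 0 <= g e) ->
  forall z, 0 <= on_vertex g z.
Proof. by move=> g0 z; rewrite /on_vertex; case: edge_to => /=. Qed.

Lemma esum_on_vertex (g : edge T -> R) (A : set (edge T)) :
  (\esum_(e in A) (g e)%:E = \esum_(z in @tgt V T @` A) (on_vertex g z)%:E)%E.
Proof.
rewrite esum_image => [|e f _ _ /tgt_inj //].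
by apply: eq_esum => e _; rewrite on_vertexE.
Qed.

(** A cutset lighter than [maxflow] would be avoided by a ray; conversely each [min_cut] is a cutset
    of weight at most [maxflow_n], which decreases to [maxflow]. *)
Lemma inf_cutset_weights_eq0 (g : edge T -> R) : (forall e, 0 <= g e) ->
  ereal_inf (cutset_weights g) = 0%E <-> maxflow T (on_vertex g) r = 0.
Proof.
move=> g0; have k0 := on_vertex_ge0 g0; split => [inf0|mf0].
  apply/eqP; rewrite eq_le maxflow_ge0// andbT leNgt; apply/negP => mf_gt0.
  have [|_ [Pi cutPi <-]] := @ereal_inf_lt _ (cutset_weights g) (maxflow T (on_vertex g) r)%:E.
    by rewrite inf0 lte_fin.
  rewrite esum_on_vertex => lt_mf.
  have [|p [pr np]] := @avoid_cut _ _ T _ k0 (@tgt V T @` Pi) r.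
    apply: le_lt_trans lt_mf; apply: esum_subset => [z [] //|z]; by rewrite lee_fin.
  have [n [e Pe ej]] := cutPi p ((ray_simple T p).1 pr).
  by apply: (np n); exists e => //; apply: joins_children ej; have [_] := pr.
apply/eqP; rewrite eq_le; apply/andP; split; last first.
  apply: le_ereal_inf_tmp => _ [Pi _ <-]; apply: esum_ge0 => e _.
  by rewrite lee_fin.
apply/lee_addgt0Pr => e e0; rewrite add0e.
have [|n ne] := @maxflow_lt _ _ T _ k0 r e; first by rewrite mf0.
set Pi := [set f : edge T | tgt f \in min_cut T (on_vertex g) n r].
apply: (@le_trans _ _ (\esum_(f in Pi) (g f)%:E)%E).
  apply: ereal_inf_lbound; exists Pi => // p /ray_simple pr.
  have [m pm] := @min_cut_ray _ _ T (on_vertex g) n r p pr.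
  have [_ /(_ m) pS] := pr; have [pr' pp] := childrenP pS.
  have [f fp] := edge_toP pr'; exists m, f; first by rewrite /Pi /= fp.
  by left; rewrite fp; have [-> _] := child_edge f; rewrite fp pp.
rewrite esum_on_vertex (le_trans (esum_subset (B := [set` min_cut T (on_vertex g) n r]) _ _))//.
  by move=> z [f + <-].
apply: (le_trans (esum_seq_le _ k0)); rewrite lee_fin ltW// (le_lt_trans _ ne)//.
exact: min_cut_weight.
Qed.

Lemma flow_on_vertex (theta : edge T -> R) y : flow theta -> y <> r ->
  on_vertex theta y = \sum_(z <- children y) on_vertex theta z.
Proof. by move=> [_ fl] yr; rewrite -sum_in_edges fl// sum_out_edges. Qed.

(** Conservation lets the amount leaving [z] replace the amount entering it, so the bound by
    [maxflow_n] climbs one generation at a time. *)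
Lemma strength_le (g theta : edge T -> R) : flow theta -> (forall e, theta e <= g e) ->
  strength theta <= maxflow T (on_vertex g) r.
Proof.
move=> fl le_g; have th0 := fl.1; have g0 e : 0 <= g e by exact: le_trans (th0 e) (le_g e).
have le_k z : on_vertex theta z <= on_vertex g z.
  by rewrite /on_vertex; case: edge_to => /=.
have key n y : \sum_(z <- children y) on_vertex theta z <= maxflow_n T (on_vertex g) n y.
  elim: n y => [|n IH] y; first exact: ler_sum.
  rewrite /maxflow_n /= big_seq [leRHS]big_seq; apply: ler_sum => z /childrenP[zr _].
  by rewrite le_min le_k/= flow_on_vertex// IH.
rewrite /strength sum_out_edges leNgt; apply/negP => /(maxflow_lt (on_vertex_ge0 g0))[n].
by apply/negP; rewrite -leNgt.
Qed.

Lemma max_flow_exists (g : edge T -> R) : (forall e, 0 <= g e) ->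
  exists theta, [/\ flow theta, forall e, theta e <= g e &
    strength theta = maxflow T (on_vertex g) r].
Proof.
move=> g0; have k0 := on_vertex_ge0 g0; pose F := maxflow T (on_vertex g).
have F0 y : 0 <= F y by exact: maxflow_ge0.
pose c z := Num.min (on_vertex g z) (F z).
have c0 z : 0 <= c z by rewrite le_min k0 F0.
have FE y : F y = \sum_(z <- children y) c z by exact: maxflowE.
(* The amount reaching a vertex is divided among its children in proportion to [c], whose sum over
   the children is [F]. Where [F] vanishes the division returns 0, which agrees with [m <= F]. *)
have [m [mr mE]] := @tree_rec _ T _ (F r) (fun z t => t * c z / F (parent z)).
have m0 : forall z, 0 <= m z.
  by apply: (tree_ind (T := T)) => [|z zr mp]; rewrite ?mr// mE// !mulr_ge0 ?invr_ge0.
have mc z : z <> r -> m (parent z) <= F (parent z) -> m z <= c z.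
  move=> zr mp; rewrite mE// mulrAC ler_piMl//.
  have [->|Fp] := eqVneq (F (parent z)) 0; first by rewrite invr0 mulr0 ler01.
  by rewrite ler_pdivrMr ?mul1r// lt0r Fp F0.
have mF : forall z, m z <= F z.
  apply: (tree_ind (T := T)) => [|z zr mp]; first by rewrite mr.
  by rewrite (le_trans (mc z zr mp))// ge_min lexx orbT.
have msum y : m y = \sum_(z <- children y) m z.
  transitivity (\sum_(z <- children y) m y * c z / F y); last first.
    by apply: eq_big_seq => z /childrenP[zr zy]; rewrite (mE z zr) zy.
  rewrite -mulr_suml -mulr_sumr -FE; have [F0y|Fy] := eqVneq (F y) 0.
    by rewrite F0y mulr0 mul0r; apply/eqP; rewrite eq_le m0 -F0y mF.
  by rewrite mulfK.
pose theta (e : edge T) := m (tgt e).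
have thE z : z <> r -> on_vertex theta z = m z.
  by move=> zr; have [e <-] := edge_toP zr; rewrite on_vertexE.
have th_out y : \sum_(z <- children y) on_vertex theta z = m y.
  by rewrite msum; apply: eq_big_seq => z /childrenP[zr _]; exact: thE.
exists theta; split.
- split=> [e|y yr]; first exact: m0.
  by rewrite sum_in_edges sum_out_edges thE// th_out.
- move=> e; have [_ er] := child_edge e; rewrite (le_trans (mc _ er (mF _)))//.
  by rewrite /c on_vertexE ge_min lexx.
- by rewrite /strength sum_out_edges th_out.
Qed.

Lemma is_MaxFlow_maxflow (g : edge T -> R) (m : R) : (forall e, 0 <= g e) ->
  is_MaxFlow g m <-> m = maxflow T (on_vertex g) r.
Proof.
move=> g0; have [theta [fl le_g st]] := max_flow_exists g0; split=> [[[th [thf thg] <-] ub]|->].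
  by apply/eqP; rewrite eq_le strength_le//= -st; apply: ub; exists theta.
split; first by exists theta.
by move=> _ [th [thf thg] <-]; exact: strength_le.
Qed.

Lemma finite_boundary (B : set V) : finite_set B -> finite_set (boundary (T := T) B).
Proof.
move=> Bf; apply: (@sub_finite_set _ _ (@tgt V T @^-1` (B `|` \bigcup_(y in B) [set` children y]))).
  move=> e [[Bs _]|[_ Bt]]; [right|by left]; exists (src e) => //=.
  by have [-> tr] := child_edge e; exact: children_parent.
apply: finite_preimage => [e f _ _ /tgt_inj//|].
by rewrite finite_setU; split => //; apply: bigcup_finite => // y _; exact: finite_seq.
Qed.

Lemma sum_boundary_rest (g : edge T -> R) (B : set V) e0 : finite_set B ->
  (forall e, 0 <= g e) ->
  ((\sum_(e \in boundary (T := T) B `\ e0) g e)%:E =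
   \esum_(z in @tgt V T @` (boundary (T := T) B `\ e0)) (on_vertex g z)%:E)%E.
Proof.
move=> Bf g0; have fb : finite_set (boundary (T := T) B `\ e0).
  exact/finite_setD/finite_boundary.
rewrite -esum_on_vertex esum_fset ?fsumEFin// => e _; by rewrite lee_fin.
Qed.

Lemma ground_states_natural (J : edge T -> R) : (forall e, J e <> 0) ->
  maxflow T (on_vertex (fun e => `|J e|)) r = 0 ->
  ground_states J = natural_ground_states J.
Proof.
move=> J0 mf0; pose g e : R := `|J e|; have g0 e : 0 <= g e by exact: normr_ge0.
have k0 := on_vertex_ge0 g0.
have kp z : z <> r -> 0 < on_vertex g z.
  by move=> zr; have [e <-] := edge_toP zr; rewrite on_vertexE normr_gt0; exact/eqP/J0.
have mf_all := maxflow_gt0_all k0 kp mf0.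
apply/seteqP; split => s [cs hs]; split => //; last first.
  by move=> B Bf; apply: fsumr_ge0 => e _; exact: hs.
have sg e : J e * s (src e) * s (tgt e) <= g e.
  apply: (le_trans (ler_norm _)); rewrite !normrM.
  by have [->|->] := cs (src e); have [->|->] := cs (tgt e); rewrite ?normrN normr1 !mulr1.
move=> e; rewrite leNgt; apply/negP => neg.
have [|n nlt] := @maxflow_lt _ _ T _ k0 (tgt e) (- (J e * s (src e) * s (tgt e))).
  by rewrite mf_all oppr_gt0.
(* Besides [e], the boundary of [B] contains only edges of the cut below [tgt e], whose total weight
   is smaller than the defect at [e]; so the boundary sum is negative. *)
pose B : set V := [set` near_side T (on_vertex g) n (tgt e)].
have Bf : finite_set B by exact: finite_seq.
have [se tr] := child_edge e.
have Bse : ~ B (src e).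
  by move=> /near_side_desc /desc_depth; rewrite se (depth_parent tr) ltnn.
have be : boundary B e by right; split => //; exact: near_side_self.
have := hs B Bf; apply/negP; rewrite -ltNge.
rewrite (fsbigD1 e)//=; last exact: finite_boundary.
rewrite -ltrBrDl sub0r (le_lt_trans _ nlt)// (le_trans _ (min_cut_weight T _ n _))//.
have fb : finite_set (boundary (T := T) B `\ e) by exact/finite_setD/finite_boundary.
apply: (@le_trans _ _ (\sum_(f \in boundary B `\ e) g f)).
  by rewrite -lee_fin -!fsumEFin//; apply: lee_fsum => // f _; rewrite lee_fin.
rewrite -lee_fin sum_boundary_rest// (le_trans _ (esum_seq_le _ k0))//.
apply: esum_subset => [_ [f [[[Bs nBt]|[nBs Bt]] fe] <-]|z]; last by rewrite lee_fin.
- have [fs ft] := child_edge f; apply: (near_side_out Bs); last exact/negP.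
  by rewrite fs; exact: children_parent.
- exfalso; apply: fe; apply: tgt_inj; have [//|] := near_side_parent Bt.
  by have [<- _] := child_edge f.
Qed.

(** Were the boundary lighter, a ray from [y] would avoid it and thus stay forever in the finite set
    [B]. *)
Lemma cut_weight_boundary (k : V -> R) (B : set V) y : (forall z, 0 <= k z) ->
  finite_set B -> B y ->
  ((maxflow T k y)%:E <= cut_weight T k (@tgt V T @` boundary B) y)%E.
Proof.
move=> k0 Bf By; rewrite leNgt; apply/negP => /(avoid_cut k0)[p [py np]].
have Bp n : B (p n).
  elim: n => [|n IH]; first by have [->] := py.
  apply: contrapT => nB; have [_ /(_ n)/childrenP[pr pp]] := py.
  have [e et] := edge_toP pr; apply: (np n); exists e => //; left.
  by rewrite et; have [-> _] := child_edge e; rewrite et pp.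
apply: infinite_nat; apply: (@sub_finite_set _ _ (p @^-1` B)) => [n _|]; first exact: Bp.
by apply: finite_preimage => // i j _ _; exact: ray_inj py _ _.
Qed.

(** If the boundary of [B] contains the unsatisfied edge, the rest of it weighs at least as much.
    For [z1] in [B], count the boundary below [z1]; for [v] and [z2] in [B], the boundary below
    [z2]; for [v] in [B] without [z2], the edge to [z2] alone suffices. *)
Lemma unnatural_ground_state (J : edge T -> R) v z1 z2 :
  let k := on_vertex (fun e => `|J e| : R) in
  z1 \in children v -> z2 \in children v -> z1 <> z2 ->
  0 < k z1 -> k z1 <= maxflow T k z1 -> k z1 <= maxflow T k z2 -> k z1 <= k z2 ->
  ground_states J <> natural_ground_states J.
Proof.
move=> k z1v z2v z12 kz1 F1 F2 k12 gn.
have g0 (e : edge T) : 0 <= `|J e| by exact: normr_ge0.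
have k0 : forall z, 0 <= k z by exact: on_vertex_ge0.
have [z1r p1] := childrenP z1v; have [z2r p2] := childrenP z2v.
have [e1 t1] := edge_toP z1r.
pose sg (x : R) : R := if 0 <= x then 1 else -1.
have sgx x : x * sg x = `|x|.
  by rewrite /sg; case: leP => x0; [rewrite mulr1 ger0_norm|rewrite mulrN1 ltr0_norm].
have sg2 x : sg x * sg x = 1 by rewrite /sg; case: ifP; rewrite ?mulrNN mulr1.
(* Spins are propagated from the root so as to satisfy every edge, with one extra flip on entering
   the subtree of [z1]. *)
have [s [sr sE]] := @tree_rec _ T _ (1 : R) (fun z t =>
  t * sg (on_vertex J z) * (if z == z1 then -1 else 1)).
have s2 : forall z, s z * s z = 1.
  apply: (tree_ind (T := T)) => [|z zr sp]; first by rewrite sr mulr1.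
  rewrite sE// mulrACA [X in X * _]mulrACA sp sg2 !mul1r.
  by case: ifP; rewrite ?mulrNN mulr1.
have cs : configuration s.
  move=> z; have /eqP := s2 z; rewrite -expr2 sqrf_eq1 => /orP[/eqP|/eqP] ->; by [right|left].
have se e : J e * s (src e) * s (tgt e) = if e == e1 then - `|J e| else `|J e|.
  have [es er] := child_edge e; rewrite (sE _ er) -es on_vertexE.
  rewrite (_ : _ * _ = s (src e) * s (src e) * (J e * sg (J e)) *
    (if tgt e == z1 then -1 else 1)); last by ring.
  rewrite s2 mul1r sgx -t1 (inj_eq (@tgt_inj _ T)).
  by case: ifP; rewrite ?mulrN1 ?mulr1.
have : natural_ground_states J s.
  rewrite -gn; split => // B Bf; have fb := finite_boundary Bf.
  case: (pselect (boundary B e1)) => be1; last first.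
    apply: fsumr_ge0 => e be; rewrite se; case: eqP => // ee.
    by rewrite ee in be.
  rewrite (fsbigD1 e1)//= se eqxx.
  rewrite (_ : \sum_(_ \in _) _ = \sum_(e \in boundary B `\ e1) `|J e|); last first.
    by apply: eq_fsbigr => e /[!inE] -[_ /eqP/negbTE]; rewrite se => ->.
  rewrite addrC subr_ge0 -lee_fin sum_boundary_rest//.
  have -> : `|J e1| = k z1 by rewrite /k -t1 on_vertexE.
  have sub y : B y -> k z1 <= maxflow T k y ->
    (forall z, desc T y z -> z <> y -> z <> z1) ->
    ((k z1)%:E <= \esum_(z in @tgt V T @` (boundary B `\ e1)) (k z)%:E)%E.
    move=> By Fy ny; rewrite (@le_trans _ _ (maxflow T k y)%:E) ?lee_fin//.
    rewrite (le_trans (cut_weight_boundary k0 Bf By))//.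
    apply: esum_subset => [z [[e be et] [dz zy]]|z]; last by rewrite lee_fin.
    by exists e => //; split => // ee; apply: (ny z) => //; rewrite -et ee.
  have [se1 _] := child_edge e1; rewrite t1 p1 in se1.
  move: be1 => [[Bv _]|[_ Bz1]]; last first.
    by rewrite t1 in Bz1; apply: (sub z1).
  rewrite se1 in Bv; case: (pselect (B z2)) => Bz2.
    apply: (sub z2) => // z dz zz2 zz1; apply: z12.
    by apply: (desc_children_uniq z1v z2v (desc_refl _ _)); rewrite -zz1.
  have [e2 t2] := edge_toP z2r; have [se2 _] := child_edge e2; rewrite t2 p2 in se2.
  apply: (@le_trans _ _ (k z2)%:E); rewrite ?lee_fin//.
  rewrite -[leLHS](@esum_set1 _ _ z2 (fun z => (k z)%:E)) ?lee_fin//.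
  apply: esum_subset => [_ ->|z]; last by rewrite lee_fin.
  exists e2 => //; split; first by left; rewrite se2 t2.
  by move=> /= ee; apply: z12; rewrite -t1 -t2 ee.
move=> [_ /(_ e1)]; rewrite se eqxx oppr_ge0 normr_le0 => /eqP J1.
by move: kz1; rewrite /k -t1 on_vertexE J1 normr0 ltxx.
Qed.

End Deterministic.

(** * Effective conductance and harmonic functions *)

Section Conductance.
Variables (R : realType) (V : choiceType) (T : rooted_tree V).
Local Notation children := (children T).
Local Notation r := (tree_root T).
Local Notation parent := (parent T).

(* The conductance of a unit resistance in series with a conductance [t]. *)
Definition unit_series (t : R) : R := t / (1 + t).

Lemma unit_series_ge0 t : 0 <= t -> 0 <= unit_series t.
Proof. by move=> t0; rewrite /unit_series divr_ge0// addr_ge0. Qed.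

Lemma unit_series_le1 t : 0 <= t -> unit_series t <= 1.
Proof. by move=> t0; rewrite /unit_series ler_pdivrMr; lra. Qed.

Lemma unit_series_gt0 t : 0 < t -> 0 < unit_series t.
Proof. by move=> t0; rewrite /unit_series divr_gt0// addr_gt0. Qed.

Lemma unit_series_mono s t : 0 <= s -> s <= t -> unit_series s <= unit_series t.
Proof.
move=> s0 st; rewrite /unit_series ler_pdivrMr; last by lra.
by rewrite mulrAC ler_pdivlMr; nra.
Qed.

(** The effective conductance from [y] to the vertices [n + 1] generations below it. *)
Definition cond_n := trec T (fun _ => unit_series) (fun y => (size (children y))%:R).
(* Effective conductance from [y] to infinity inside the subtree of [y], every
   edge having unit resistance. *)
Definition cond := tlim T (fun _ => unit_series) (fun y => (size (children y))%:R).

Let size_ge (y : V) : \sum_(z <- children y) unit_series (size (children z))%:R <= (size (children y))%:R :> R.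
Proof.
rewrite -sum1_size natr_sum; apply: ler_sum => z _; exact: unit_series_le1.
Qed.

Local Ltac cond_side := solve [by move=> _ *; exact: unit_series_ge0 |
  by move=> _ *; exact: unit_series_mono | by [] | exact: size_ge].

Lemma cond_n_ge0 n y : 0 <= cond_n n y.
Proof. by apply: trec_ge0; cond_side. Qed.

Lemma cond_ge0 y : 0 <= cond y.
Proof. by apply: tlim_ge0; cond_side. Qed.

Lemma cond_lt y c : cond y < c -> exists n, cond_n n y < c.
Proof. by apply: tlim_lt; cond_side. Qed.

Lemma condE y : cond y = \sum_(z <- children y) unit_series (cond z).
Proof.
apply: tlimE; try cond_side; move=> _ u l u0 l0 ul.
apply: cvgM => //; apply: cvgV; first by rewrite gt_eqF// ltr_pwDl.
by apply: cvgD => //; exact: cvg_cst.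
Qed.

Lemma cond_eq0_all : cond r = 0 -> forall y, cond y = 0.
Proof.
move=> cr; apply: (tree_ind (T := T)) => [//|z zr cp].
have /esym/eqP := condE (parent z); rewrite cp psumr_eq0 => [|w _]; last exact/unit_series_ge0/cond_ge0.
move=> /allP/(_ _ (children_parent zr))/= h0; apply/eqP; move: h0; apply: contraTT => cz.
by rewrite gt_eqF// unit_series_gt0// lt0r cz cond_ge0.
Qed.

(* Otherwise every vertex of positive conductance has a single child of positive
   conductance, and the resistance drops by 1 at each generation. *)
Lemma cond_branching : 0 < cond r -> exists v z1 z2,
  [/\ z1 \in children v, z2 \in children v, z1 <> z2, 0 < cond z1 & 0 < cond z2].
Proof.
move=> cr; apply: contrapT => nobranch.
suff key n : forall y, 0 < cond y -> n%:R * cond y < 1.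
  have [n] : exists n : nat, (cond r)^-1 < n%:R.
    by exists (Num.bound (cond r)^-1); apply: archi_boundP; rewrite invr_ge0 ltW.
  by rewrite -(ltr_pM2r cr) mulVf ?gt_eqF// => /lt_trans/(_ (key n r cr)); rewrite ltxx.
elim: n => [|n IH] y cy; first by rewrite mul0r.
have [z zy cz] : exists2 z, z \in children y & 0 < cond z.
  apply: contrapT => /forall2NP nz; move: cy; rewrite condE big_seq big1 ?ltxx// => z zy.
  have [//|/negP] := nz z; rewrite -leNgt => cz.
  by rewrite (_ : cond z = 0) /unit_series ?mul0r//; apply/eqP; rewrite eq_le cz cond_ge0.
rewrite condE (bigD1_seq z) ?children_uniq//= big1_seq => [|w /andP[wz wy]]; last first.
  rewrite (_ : cond w = 0) /unit_series ?mul0r//; apply/eqP; rewrite eq_le cond_ge0 andbT.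
  rewrite leNgt; apply/negP => cw; apply: nobranch; exists y, w, z; split => //.
  exact/eqP.
have := IH z cz; rewrite addr0 /unit_series mulrA ltr_pdivrMr; last by lra.
by rewrite -natr1; lra.
Qed.

(** * Bounded harmonic functions on the tree *)

Definition harmonic_at (q : V -> R) (y : V) : Prop :=
  \sum_(z <- nbr T y) (q z - q y) = 0.

Lemma harmonic_root q : harmonic_at q r <-> \sum_(z <- children r) (q z - q r) = 0.
Proof. by rewrite /harmonic_at (perm_big _ (nbr_root T)). Qed.

Lemma harmonic_nonroot q y : y <> r ->
  harmonic_at q y <-> q y - q (parent y) = \sum_(z <- children y) (q z - q y).
Proof.
move=> yr; rewrite /harmonic_at (perm_big _ (nbr_nonroot yr)) big_cons /=; split.
  by move=> /eqP; rewrite addrC addr_eq0 => /eqP ->; rewrite opprB.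
by move=> <-; ring.
Qed.

(** By harmonicity the left side is the current through the edge above [y]. It is at most the
    current obtained by holding the vertices [n + 1] generations below [y] at the maximal potential
    1. *)
Lemma drop_le (q : V -> R) n y : (forall z, q z <= 1) -> y <> r ->
  (forall z, desc T y z -> harmonic_at q z) ->
  q y - q (parent y) <= (1 - q y) * cond_n n y.
Proof.
move=> q1; elim: n y => [|n IH] y yr hq.
  rewrite ((harmonic_nonroot _ yr).1 (hq y (desc_refl _ _))).
  apply: (@le_trans _ _ (\sum_(z <- children y) (1 - q y))).
    by apply: ler_sum => z _; rewrite lerD2r.
  by rewrite big_const_seq count_predT iter_addr_0 mulr_natr.
rewrite ((harmonic_nonroot _ yr).1 (hq y (desc_refl _ _))) /cond_n /= mulr_sumr.
rewrite big_seq [leRHS]big_seq; apply: ler_sum => z zy; have [zr pz] := childrenP zy.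
have := IH z zr (fun w zw => hq w (desc_children zy zw)); rewrite pz.
have := cond_n_ge0 n z; rewrite -/(cond_n n z); move: (cond_n n z) => c c0 le.
by rewrite /unit_series mulrA ler_pdivlMr; nra.
Qed.

(** [drop_le] with [cond_n] tending to 0 gives one inequality; the other one is the same statement
    for [1 - q]. *)
Lemma harmonic_subtree_flat (q : V -> R) y : cond r = 0 ->
  (forall z, 0 <= q z <= 1) -> y <> r ->
  (forall z, desc T y z -> harmonic_at q z) -> q y = q (parent y).
Proof.
move=> cr q01 yr hq.
have flat (p : V -> R) : (forall z, 0 <= p z <= 1) -> (forall z, desc T y z -> harmonic_at p z) ->
    p y <= p (parent y).
  move=> p01 hp; rewrite -subr_le0; apply/ler_addgt0Pr => e e0; rewrite add0r.
  have [|n ne] := @cond_lt y e; first by rewrite cond_eq0_all.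
  apply: (le_trans (@drop_le p n y _ yr hp)) => [z|]; first by have /andP[] := p01 z.
  by have := cond_n_ge0 n y; have /andP[? ?] := p01 y; nra.
apply/eqP; rewrite eq_le flat//= -lerN2 -(lerD2l 1).
apply: (flat (fun z => 1 - q z)) => [z|z /hq].
  by have /andP[? ?] := q01 z; apply/andP; split; lra.
rewrite /harmonic_at => hz.
transitivity (- \sum_(w <- nbr T z) (q w - q z)); last by rewrite hz oppr0.
by rewrite -sumrN; apply: eq_bigr => w _; ring.
Qed.

(** Every edge is shown to be flat, from the root downwards. Off the path to [x] this is
    [harmonic_subtree_flat]. On that path the parent [p] of [z] differs from [x], and all neighbours
    of [p] other than [z] already have the value [q p]; harmonicity at [p] then forces
    [q z = q p]. *)
Lemma harmonic_off_point_eq0 (q : V -> R) x : cond r = 0 ->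
  (forall z, 0 <= q z <= 1) -> q x = 0 -> (forall y, y <> x -> harmonic_at q y) ->
  forall y, q y = 0.
Proof.
move=> cr q01 qx hq.
have off y : y <> r -> ~ desc T y x -> q y = q (parent y).
  move=> yr yx; apply: harmonic_subtree_flat => // z yz; apply: hq => zx.
  by apply: yx; rewrite -zx.
have flat : forall y, y <> r -> q y = q (parent y).
  apply: (tree_ind (T := T)) => [//|z zr IH _].
  case: (pselect (desc T z x)) => zx; last exact: off.
  have zp := children_parent zr; set p := parent z in IH zp *.
  have px : p <> x.
    by move=> px; have := desc_depth zx; rewrite (depth_parent zr) -/p px ltnn.
  have : \sum_(w <- children p) (q w - q p) = 0.
    have := hq p px; case: (pselect (p = r)) => [->|pr]; first by rewrite harmonic_root.
    by move=> /(harmonic_nonroot _ pr) <-; rewrite -IH// subrr.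
  rewrite (bigD1_seq z) ?children_uniq//= big1_seq ?addr0.
    by move=> /eqP; rewrite subr_eq0 => /eqP.
  move=> w /andP[/eqP wz wp]; have [wr pw] := childrenP wp.
  rewrite off// ?pw ?subrr// => wx; apply: wz; exact: desc_children_uniq wp zp wx zx.
have cst : forall y, q y = q r.
  by apply: (tree_ind (T := T)) => [//|z zr IH]; rewrite flat.
by move=> y; rewrite cst -(cst x).
Qed.

Lemma harmonic_off_root : 0 < cond r -> exists q : V -> R,
  [/\ forall z, 0 <= q z <= 1, q r = 0, forall y, y <> r -> harmonic_at q y &
      exists2 z, z \in nbr T r & 0 < q z].
Proof.
move=> cr.
(* Voltage divider: below the parent of [z], a unit resistance in series with a conductance
   [cond z]. The function sought is [1 - v]. *)
have [v [vr vE]] := @tree_rec _ T _ (1 : R) (fun z t => t / (1 + cond z)).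
have v01 : forall z, 0 < v z <= 1.
  apply: (tree_ind (T := T)) => [|z zr /andP[v0 v1]]; first by rewrite vr ltr01 lexx.
  have c0 := cond_ge0 z.
  by rewrite vE// divr_gt0 ?ltr_pwDl//= ler_pdivrMr; nra.
have drop z : z <> r -> v (parent z) - v z = v z * cond z.
  by move=> zr; have := cond_ge0 z => c0; rewrite (vE z zr); field; rewrite gt_eqF// ltr_pwDl.
have drop' y z : z \in children y -> v y - v z = v y * unit_series (cond z).
  move=> /childrenP[zr <-]; have := cond_ge0 z => c0; rewrite (vE z zr) /unit_series; field.
  by rewrite gt_eqF// ltr_pwDl.
exists (fun z => 1 - v z); split.
- by move=> z; have /andP[? ?] := v01 z; apply/andP; split; lra.
- by rewrite vr subrr.
- move=> y yr; apply/harmonic_nonroot => //.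
  rewrite (_ : _ - _ = v (parent y) - v y); last by ring.
  rewrite drop// condE mulr_sumr; apply: eq_big_seq => z zy.
  by rewrite -(drop' _ _ zy); ring.
have [z zr cz] : exists2 z, z \in children r & 0 < cond z.
  apply: contrapT => /forall2NP nz; move: cr; rewrite condE big_seq big1 ?ltxx// => z zy.
  have [//|/negP] := nz z; rewrite -leNgt => cz.
  by rewrite (_ : cond z = 0) /unit_series ?mul0r//; apply/eqP; rewrite eq_le cz cond_ge0.
exists z; first exact: children_adj zr.
by rewrite subr_gt0 -vr -subr_gt0 drop'// vr mul1r unit_series_gt0.
Qed.

End Conductance.

(** * Simple random walk *)

Section Walk.
Variables (R : realType) (V : choiceType) (T : rooted_tree V).
Local Notation r := (tree_root T).
Local Notation prob := (srw_prob R T).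

(** The possible next positions, never empty: on the one-vertex tree the walk stays put. Each step
    is uniform on this list. *)
Definition succs (y : V) : seq V := if nbr T y == fset0 then [:: y] else nbr T y.

Lemma succs_uniq y : uniq (succs y).
Proof. by rewrite /succs; case: ifP => // _; exact: fset_uniq. Qed.

Lemma size_succs_gt0 y : (0 < size (succs y))%N.
Proof. by rewrite /succs; case: ifPn => //; rewrite -cardfs_eq0 lt0n. Qed.

Lemma srw_probE y z : prob y z = if z \in succs y then (size (succs y))%:R^-1 else 0.
Proof.
rewrite /srw_prob /succs cardfs_eq0; case: ifP => _.
  by rewrite inE eq_sym; case: eqP => _; rewrite ?invr1.
by rewrite /adj; case: ifP; rewrite ?mul1r ?mul0r.
Qed.

Lemma srw_prob_ge0 y z : 0 <= prob y z.
Proof. by rewrite srw_probE; case: ifP. Qed.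

Lemma sum_srw_prob y (q : V -> R) : \sum_(z <- succs y) prob y z * q z =
  (size (succs y))%:R^-1 * \sum_(z <- succs y) q z.
Proof. by rewrite mulr_sumr; apply: eq_big_seq => z zy; rewrite srw_probE zy. Qed.

Lemma sum_srw_prob1 y : \sum_(z <- succs y) prob y z = 1.
Proof.
under eq_bigr do rewrite -[prob _ _]mulr1.
rewrite sum_srw_prob big_const_seq count_predT iter_addr_0 mulVf//.
by rewrite pnatr_eq0 -lt0n size_succs_gt0.
Qed.

Lemma harmonic_mean (q : V -> R) y :
  harmonic_at T q y <-> q y = \sum_(z <- succs y) prob y z * q z.
Proof.
have n0 : (size (succs y))%:R != 0 :> R by rewrite pnatr_eq0 -lt0n size_succs_gt0.
have -> : harmonic_at T q y <-> \sum_(z <- succs y) (q z - q y) = 0.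
  rewrite /harmonic_at /succs; case: ifPn => [/eqP y0|//].
  by rewrite y0 big_seq1 subrr big_seq_fset0.
rewrite sum_srw_prob sumrB big_const_seq count_predT iter_addr_0 -(mulr_natl (q y)).
split=> [/eqP|qy]; first by rewrite subr_eq0 => /eqP ->; rewrite mulKf.
by rewrite qy mulVKf// subrr.
Qed.

(** The probability that the walk started at [y] avoids [x] at the times [1, ..., n]; time 0 is not
    tested, so [y = x] is meaningful. *)
Fixpoint miss (x : V) (n : nat) (y : V) : R :=
  if n is n'.+1 then \sum_(z <- succs y | z != x) prob y z * miss x n' z else 1.

Definition off (x : V) (u : V -> R) (y : V) : R := if y == x then 0 else u y.

Lemma missS x n y : miss x n.+1 y = \sum_(z <- succs y) prob y z * off x (miss x n) z.
Proof.
rewrite /= big_mkcond; apply: eq_bigr => z _.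
by rewrite /off; case: eqP; rewrite ?mulr0.
Qed.

Lemma miss_ge0 x n y : 0 <= miss x n y.
Proof.
elim: n y => [//|n IH] y /=; apply: sumr_ge0 => z _.
by rewrite mulr_ge0 ?srw_prob_ge0.
Qed.

Lemma off_mono x (u v : V -> R) : (forall y, u y <= v y) -> forall y, off x u y <= off x v y.
Proof. by move=> uv y; rewrite /off; case: ifP. Qed.

Lemma miss_noninc x y : nonincreasing_seq (fun n => miss x n y).
Proof.
apply/nonincreasing_seqP => n; elim: n y => [|n IH] y.
  rewrite missS /= -[leRHS](sum_srw_prob1 y); apply: ler_sum => z _.
  by rewrite ler_piMr ?srw_prob_ge0// /off; case: ifP.
rewrite !missS; apply: ler_sum => z _.
by apply: ler_wpM2l; [exact: srw_prob_ge0|exact: off_mono].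
Qed.

Lemma cvg_miss x y : cvgn (fun n => miss x n y).
Proof.
apply: nonincreasing_is_cvgn; first exact: miss_noninc.
by exists 0 => _ [n _ <-]; exact: miss_ge0.
Qed.

(** The limit of [miss], reset to 0 at [x], is bounded and harmonic off [x], hence identically 0;
    the one-step equation at [x] then makes the limit itself vanish there. *)
Lemma miss_recurrent x : cond R T r = 0 -> (fun n => miss x n x) @ \oo --> (0 : R).
Proof.
move=> cr; pose ms y : R := limn (fun n => miss x n y).
have cms y : (fun n => miss x n y) @ \oo --> ms y by exact: cvg_miss.
have msE y : ms y = \sum_(z <- succs y) prob y z * off x ms z.
  have cS : (fun n => miss x n.+1 y) @ \oo --> ms y.
    by rewrite (cvg_shiftS (fun n => miss x n y)).
  apply: (cvg_unique _ cS) => //.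
  rewrite (_ : (fun n => miss x n.+1 y) =
    fun n => \sum_(z <- succs y) prob y z * off x (miss x n) z); last first.
    by apply/funext => n; exact: missS.
  apply: cvg_sum_seq => z; apply: cvgM; first exact: cvg_cst.
  by rewrite /off; case: ifP => _; [exact: cvg_cst|exact: cms].
have ms01 y : 0 <= ms y <= 1.
  apply/andP; split.
    by apply: limr_ge; [exact: cvg_miss|apply: nearW => n; exact: miss_ge0].
  apply: limr_le; [exact: cvg_miss|apply: nearW => n].
  exact: (miss_noninc x y (leq0n n)).
have off0 : forall y, off x ms y = 0.
  apply: (harmonic_off_point_eq0 (x := x) cr) => [y||y yx].
  - by rewrite /off; case: ifP => _; rewrite ?lexx ?ler01.
  - by rewrite /off eqxx.
  - by apply/harmonic_mean; rewrite -msE /off; case: eqP.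
rewrite (_ : 0 = ms x)//; rewrite msE big1// => z _; by rewrite off0 mulr0.
Qed.

(** The function [q] stays below [miss] off the root, by induction on [n]; its mean over the
    neighbours of the root is the positive bound [d]. *)
Lemma miss_transient : 0 < cond R T r ->
  exists2 d : R, 0 < d & forall n, d <= miss r n r.
Proof.
move=> /harmonic_off_root[q [q01 qr hq [z zr qz]]].
have nr : z \in succs r.
  by rewrite /succs; case: ifPn => // /eqP r0; rewrite r0 inE in zr.
have q_le n y : q y <= off r (miss r n) y.
  elim: n y => [|n IH] y; rewrite /off; case: eqP => [->|yr]; rewrite ?qr//.
    by have /andP[] := q01 y.
  rewrite ((harmonic_mean _ _).1 (hq y yr)) missS; apply: ler_sum => w _.
  by rewrite ler_wpM2l ?srw_prob_ge0.
exists (\sum_(z <- succs r) prob r z * q z).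
  rewrite sum_srw_prob mulr_gt0 ?invr_gt0 ?ltr0n ?size_succs_gt0//.
  rewrite (bigD1_seq z) ?succs_uniq//= ltr_pwDl// sumr_ge0// => w _.
  by have /andP[] := q01 w.
have le n : \sum_(z <- succs r) prob r z * q z <= miss r n.+1 r.
  by rewrite missS; apply: ler_sum => w _; rewrite ler_wpM2l ?srw_prob_ge0.
by move=> n; apply: (le_trans (le n)); apply: miss_noninc; exact: leqnSn.
Qed.

(** * Escape probabilities of an arbitrary realization of the walk *)

Section Realization.
Variables (d : measure_display) (Omega : measurableType d) (P : probability Omega R).
Variables (x0 : V) (X : nat -> Omega -> V).
Hypothesis HX : simple_random_walk T x0 P X.

Lemma measurable_notin (f : Omega -> V) (s : seq V) :
  (forall y, measurable (f @^-1` [set y])) -> measurable [set w | f w \notin s].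
Proof.
move=> maxflow_n; rewrite (_ : [set _ | _] = ~` \bigcup_(y in [set` s]) f @^-1` [set y]).
  by apply: measurableC; apply: fin_bigcup_measurable => // y _; exact: maxflow_n.
apply/seteqP; split => w /= ws; first by move=> [y /= ys wy]; rewrite wy ys in ws.
by apply/negP => fw; apply: ws; exists (f w).
Qed.

(** [V] carries no sigma-algebra and only the events [f = y] are assumed measurable, so total
    probability is stated for a finite list and a remainder. *)
Lemma measure_split (A : set Omega) (f : Omega -> V) (s : seq V) : measurable A ->
  (forall y, measurable (f @^-1` [set y])) -> uniq s ->
  P A = (\sum_(z <- s) P (A `&` f @^-1` [set z]) +
         P (A `&` [set w | f w \notin s]))%E.
Proof.
move=> mA maxflow_n; elim: s => [_|z s IH /= /andP[zs us]].
  by rewrite big_nil add0e; congr (P _); apply/seteqP; split => w //= [].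
rewrite (IH us) big_cons -addeA addeCA; congr (_ + _)%E.
rewrite -measureU//; last 3 first.
- by apply: measurableI => //; exact: maxflow_n.
- by apply: measurableI => //; exact: measurable_notin.
- by apply/seteqP; split => w //= [[_ ->] [_]]; rewrite mem_head.
congr (P _); apply/seteqP; split => w /= [].
  move=> Aw ws; have [->|wz] := eqVneq (f w) z; first by left.
  by right; split => //; rewrite inE negb_or wz.
  by move=> [Aw ->].
by rewrite inE negb_or => -[Aw /andP[]].
Qed.

Definition cyl (m : nat) (p : nat -> V) : set Omega :=
  [set w | forall i, (i <= m)%N -> X i w = p i].

Definition cyl_miss (m n : nat) (p : nat -> V) : set Omega :=
  [set w | cyl m p w /\ forall i, (m < i <= m + n)%N -> X i w <> x0].

Lemma measurable_at (i : nat) (y : V) : measurable [set w | X i w = y].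
Proof. by have [mX _] := HX; exact: mX. Qed.

Lemma measurable_cyl m p : measurable (cyl m p).
Proof.
rewrite (_ : cyl m p = \bigcap_(i in `I_m.+1) [set w | X i w = p i]).
  by apply: fin_bigcap_measurable => // i _; exact: measurable_at.
by apply/seteqP; split => w h i; [move=> /h|exact: h].
Qed.

Lemma measurable_cyl_miss m n p : measurable (cyl_miss m n p).
Proof.
rewrite (_ : cyl_miss m n p = cyl m p `&`
    \bigcap_(i in [set i | (m < i <= m + n)%N]) ~` [set w | X i w = x0]).
  apply: measurableI; first exact: measurable_cyl.
  apply: bigcap_measurableType => // i _; exact/measurableC/measurable_at.
by apply/seteqP; split => w [cw hw]; split.
Qed.

Definition upd (m : nat) (p : nat -> V) (z : V) (i : nat) : V :=
  if (i <= m)%N then p i else z.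

Lemma cyl_upd m p z : cyl m.+1 (upd m p z) = cyl m p `&` X m.+1 @^-1` [set z].
Proof.
apply/seteqP; split => w /= h.
  split=> [i im|]; last by rewrite (h m.+1)// /upd ltnn.
  by rewrite h /upd ?im// ltnW.
case: h => h1 h2 i; rewrite leq_eqVlt => /predU1P[->|im].
  by rewrite /upd ltnn.
by rewrite /upd -ltnS im h1.
Qed.

Lemma prob_cylS m p z : P (cyl m.+1 (upd m p z)) = (P (cyl m p) * (prob (p m) z)%:E)%E.
Proof.
have [_ law] := HX; rewrite !law -EFinM /upd leq0n big_ord_recr/= leqnn ltnn mulrA.
by congr ((_ * _) * _)%:E; apply: eq_bigr => i _; rewrite (ltnW (ltn_ord i)) ltn_ord.
Qed.

(** Only cylinder probabilities are prescribed. Those of the one-step extensions within [succs]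
    already add up to the probability of the cylinder, so nothing remains for any other move. *)
Lemma prob_leave m p : P (cyl m p `&` [set w | X m.+1 w \notin succs (p m)]) = 0%E.
Proof.
have := @measure_split (cyl m p) (X m.+1) (succs (p m)) (measurable_cyl m p)
  (fun y => measurable_at m.+1 y) (succs_uniq _).
under eq_bigr do rewrite -cyl_upd prob_cylS.
have [_ law] := HX; rewrite {1 2}/cyl law.
under eq_bigr do rewrite -EFinM.
rewrite sumEFin -mulr_sumr sum_srw_prob1 mulr1.
set a := _%:E; set b := P _ => ab.
by rewrite -[b](@addeK _ a)// (addeC b) -ab subee.
Qed.

(** The Markov property at time [m], obtained by splitting according to the position at time
    [m + 1]. *)
Lemma prob_cyl_miss m n p : P (cyl_miss m n p) = (P (cyl m p) * (miss x0 n (p m))%:E)%E.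
Proof.
elim: n m p => [|n IH] m p.
  rewrite mule1; congr (P _); apply/seteqP; split => [w []//|w cw]; split => // i.
  by rewrite addn0; lia.
rewrite (@measure_split _ (X m.+1) (succs (p m)) (measurable_cyl_miss _ _ _)
  (fun y => measurable_at m.+1 y) (succs_uniq _)).
rewrite [X in (_ + X)%E](_ : _ = 0%E) ?adde0; last first.
  apply/eqP; rewrite eq_le measure_ge0 andbT -(prob_leave m p) le_measure ?inE//.
  - apply: measurableI; first exact: measurable_cyl_miss.
    by apply: measurable_notin => y; exact: measurable_at.
  - apply: measurableI; first exact: measurable_cyl.
    by apply: measurable_notin => y; exact: measurable_at.
  - by move=> w [[]].
have [_ /(_ m p) law] := HX; rewrite -/(cyl m p) in law.
rewrite law missS -EFinM mulr_sumr -sumEFin.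
apply: eq_bigr => z _; rewrite /off; case: (z =P x0) => [->|zx].
  rewrite !mulr0; apply/eqP; rewrite -measure_le0 -(@measure0 _ _ _ P).
  rewrite le_measure ?inE//.
    by apply: measurableI; [exact: measurable_cyl_miss|exact: measurable_at].
  by move=> w [[_ nx] wx]; apply: (nx m.+1 _ wx); rewrite ltnSn addnS ltnS leq_addr.
rewrite EFinM -law EFinM muleA -prob_cylS.
have -> : cyl_miss m n.+1 p `&` X m.+1 @^-1` [set z] = cyl_miss m.+1 n (upd m p z).
  apply/seteqP; split => w; rewrite /cyl_miss cyl_upd /=.
    by move=> [[cw hw] wz]; split => // i im; apply: hw; lia.
  move=> [[cw wz] hw]; split => //; split => // i im.
  have [->|im1] := eqVneq i m.+1; first by rewrite wz.
  by apply: hw; lia.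
by rewrite IH /upd ltnn.
Qed.

Definition never : set Omega := [set w | forall n, (0 < n)%N -> X n w <> x0].

Lemma measurable_never : measurable never.
Proof.
rewrite (_ : never = \bigcap_(i in [set i | (0 < i)%N]) ~` [set w | X i w = x0]).
  apply: bigcap_measurableType => // i _; exact/measurableC/measurable_at.
by apply/seteqP; split => w.
Qed.

Lemma prob_start : P (cyl 0 (fun=> x0)) = 1%E.
Proof. by have [_ law] := HX; rewrite law eqxx big_ord0 mulr1. Qed.

(** The walk starts at [x0] only almost surely, hence the intersection with the cylinder at time
    0. *)
Lemma cvg_prob_never :
  (fun n => (miss x0 n x0)%:E) @ \oo --> P (never `&` cyl 0 (fun=> x0)).
Proof.
rewrite (_ : (fun n => _) = P \o (fun n => cyl_miss 0 n (fun=> x0))); last first.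
  by apply/funext => n /=; rewrite prob_cyl_miss prob_start mul1e.
rewrite (_ : never `&` _ = \bigcap_n cyl_miss 0 n (fun=> x0)); last first.
  apply/seteqP; split => [w [nw cw] n _|w hw].
    by split => // i /andP[i0 _]; exact: nw.
  split; last by have [] := hw 0%N I.
  by move=> n n0; have [_] := hw n I; apply; rewrite n0 add0n leqnn.
apply: nonincreasing_cvg_mu.
- by rewrite (le_lt_trans (probability_le1 _ _)) ?ltry//; exact: measurable_cyl_miss.
- by move=> n; exact: measurable_cyl_miss.
- by apply: bigcap_measurableType => // n _; exact: measurable_cyl_miss.
- move=> m n mn; apply/subsetPset => w [cw hw]; split => // i /andP[i0 im].
  by apply: hw; rewrite i0 (leq_trans im).
Qed.

End Realization.

Lemma probability_setI_conull d (Omega : measurableType d) (P : probability Omega R)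
  (A B : set Omega) : measurable A -> measurable B -> P B = 1%E -> P (A `&` B) = P A.
Proof.
move=> mA mB PB; rewrite [RHS](@measureDI _ _ _ P A B)// [X in (X + _)%E](_ : _ = 0%E) ?add0e//.
apply/eqP; rewrite -measure_le0; apply: (@le_trans _ _ (P (~` B))).
  by rewrite le_measure ?inE//; [exact: measurableD|exact: measurableC].
by rewrite probability_setC// PB subee.
Qed.

Lemma cond_eq0_recurrent : cond R T r = 0 -> srw_recurrent R T.
Proof.
move=> cr x d Omega P X HX.
have mn := measurable_never HX; have mc := measurable_cyl HX 0 (fun=> x).
exists (never x X); split => //; last first.
  by move=> w /= nw n n0 xw; apply: nw; exists n.
rewrite -(@probability_setI_conull _ _ P _ _ mn mc (prob_start HX)).
apply: (cvg_unique _ (cvg_prob_never HX)) => //.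
by apply: cvg_EFin; [exact: nearW|exact: miss_recurrent].
Qed.


(** * A simple random walk realized on the unit interval *)

Section Interval.
(* If [u] is uniform on [0, 1[, then so is [d u - floor (d u)], independently of the
   index [floor (d u)] of the next vertex among the [d] candidates. *)
Definition walk_step (yu : V * R) : V * R :=
  let s := succs yu.1 in let k := Num.truncn ((size s)%:R * yu.2) in
  (nth yu.1 s k, (size s)%:R * yu.2 - k%:R).

Definition walk_from (y : V) (n : nat) (u : R) : V := (iter n walk_step (y, u)).1.

Lemma walk_fromS y n u : walk_from y n.+1 u =
  walk_from (walk_step (y, u)).1 n (walk_step (y, u)).2.
Proof. by rewrite /walk_from iterSr -surjective_pairing. Qed.

Lemma walk_step_itv y u (k : nat) : (k < size (succs y))%N ->
  k%:R <= (size (succs y))%:R * u < k.+1%:R ->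
  walk_step (y, u) = (nth y (succs y) k, (size (succs y))%:R * u - k%:R).
Proof. by move=> ks /truncn_def e; rewrite /walk_step /= e. Qed.

Local Ltac vlra :=
  repeat match goal with H : @eq (Choice.sort V) _ _ |- _ => clear H end; lra.

(** The points whose walk follows [p] for [n] steps form a half-open interval whose length is the
    probability of that path. *)
Lemma walk_cylinder n y (p : nat -> V) : exists a : R,
  let l := (p 0%N == y)%:R * \prod_(i < n) prob (p i) (p i.+1) in
  [/\ 0 <= a, a + l <= 1 & forall u : R, 0 <= u < 1 ->
    ((forall i, (i <= n)%N -> walk_from y i u = p i) <-> a <= u < a + l)].
Proof.
elim: n y p => [|n IH] y p.
  exists 0; split => //; rewrite big_ord0 mulr1 add0r; first by rewrite lern1 leq_b1.
  move=> u u01; case: eqP => [py|py].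
    by rewrite u01; split => // _ [|i].
  by split => [/(_ 0%N isT)/esym//|]; rewrite mulr0n; have /andP[] := u01; vlra.
have d0 : 0 < (size (succs y))%:R :> R by rewrite ltr0n size_succs_gt0.
case: (pselect (p 0%N = y /\ p 1%N \in succs y)) => [[py p1]|np]; last first.
  exists 0; have -> : (p 0%N == y)%:R * \prod_(i < n.+1) prob (p i) (p i.+1) = 0.
    case: eqP => py; last by rewrite mul0r.
    rewrite big_ord_recl /= py srw_probE ifF ?mul0r ?mulr0//.
    by apply/negP => p1; apply: np.
  split; rewrite ?addr0// => u u01; split => [h|]; last by vlra.
  exfalso; apply: np; have py : p 0%N = y by rewrite -h.
  split => //; rewrite -(h 1%N)// walk_fromS /walk_from /= mem_nth//.
  rewrite truncn_lt_nat ?mulr_ge0//; last by vlra.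
  by rewrite -[ltRHS]mulr1 ltr_pM2l//; vlra.
have [a [a0 al IHa]] := IH (p 1%N) (fun i => p i.+1).
set l := _ * _ in al IHa; set D := (size (succs y))%:R in d0 *.
pose k := index (p 1%N) (succs y).
have ks : (k < size (succs y))%N by rewrite index_mem.
have nk : nth y (succs y) k = p 1%N by rewrite nth_index.
have -> : (p 0%N == y)%:R * \prod_(i < n.+1) prob (p i) (p i.+1) = l / D.
  rewrite py eqxx mul1r big_ord_recl /= py srw_probE p1 mulrC /l eqxx mul1r.
  by congr (_ * _); apply: eq_bigr => i _.
exists ((k%:R + a) / D) => /=; rewrite -mulrDl.
have l0 : 0 <= l.
  by rewrite mulr_ge0// prodr_ge0// => i _; exact: srw_prob_ge0.
have kD : k%:R + 1 <= D by rewrite natr1 ler_nat.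
split; first by rewrite divr_ge0 ?addr_ge0// ltW.
  by rewrite ler_pdivrMr// mul1r; vlra.
move=> u u01; rewrite ler_pdivrMr// ltr_pdivlMr// [u * D]mulrC.
have Du : 0 <= D * u < D.
  by apply/andP; split; [rewrite mulr_ge0//|rewrite -[ltRHS]mulr1 ltr_pM2l//]; vlra.
have kitv := @truncn_itv _ (D * u) _; split => [h|/andP[h1 h2]].
  have [k' k'D stepE] : exists2 k', (k' < size (succs y))%N & k'%:R <= D * u < k'.+1%:R.
    exists (Num.truncn (D * u)); last by apply: kitv; vlra.
    by rewrite truncn_lt_nat; vlra.
  have st := walk_step_itv k'D stepE.
  have k'k : k' = k.
    apply/eqP; rewrite -(nth_uniq y k'D ks (succs_uniq y)) nk; apply/eqP.
    by have := h 1%N isT; rewrite walk_fromS st.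
  rewrite {}k'k nk in st stepE.
  have := (IHa (D * u - k%:R) _).1; rewrite -natr1 in stepE.
  suff hi : forall i, (i <= n)%N -> walk_from (p 1%N) i (D * u - k%:R) = p i.+1.
    by move=> /(_ _ hi); vlra.
  by move=> i im; have := h i.+1 im; rewrite walk_fromS st.
have stepE : k%:R <= D * u < k.+1%:R by rewrite -natr1; vlra.
have st := walk_step_itv ks stepE; rewrite nk in st.
case=> [|i] im; first by rewrite py.
rewrite walk_fromS st -/D /=; apply: (IHa _ _).2 => //.
  by rewrite -natr1 in stepE; vlra.
by vlra.
Qed.

(** The sample space is all of [R]; outside [[0, 1[], which has uniform probability 0, the walk is
    frozen. *)
Definition unit_walk (y : V) (n : nat) (u : R) : V :=
  if 0 <= u < 1 then walk_from y n u else y.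

Lemma unit_itvE : [set u : R | 0 <= u < 1] = `[0, 1[%classic.
Proof. by apply/seteqP; split => u /=; rewrite in_itv. Qed.

Lemma measurable_walk_from n y z :
  measurable ([set u | 0 <= u < 1 /\ walk_from y n u = z] : set R).
Proof.
elim: n y => [|n IH] y.
  have [->|yz] := eqVneq y z.
    rewrite (_ : [set _ | _] = `[0, 1[%classic); first exact: measurable_itv.
    by rewrite -unit_itvE; apply/seteqP; split => u //= [].
  rewrite (_ : [set _ | _] = set0); first exact: measurable0.
  by apply/seteqP; split => u //= [_]; apply/eqP.
set D : R := (size (succs y))%:R.
have d0 : 0 < D by rewrite ltr0n size_succs_gt0.
rewrite (_ : [set _ | _] = \bigcup_(k in `I_(size (succs y)))
    ((fun u : R => D * u - k%:R) @^-1`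
      [set u | 0 <= u < 1 /\ walk_from (nth y (succs y) k) n u = z])).
  apply: fin_bigcup_measurable => // k _; rewrite -[X in measurable X]setTI.
  suff : measurable_fun [set: R] (fun u : R => D * u - k%:R) by apply.
  by apply: measurable_funB => //; exact: mulrl_measurable.
apply/seteqP; split => u /= [].
  move=> u01 wz; have Du : 0 <= D * u < D.
    by apply/andP; split; [rewrite mulr_ge0//|rewrite -[ltRHS]mulr1 ltr_pM2l//]; vlra.
  have /andP[Du0 DuD] := Du; have stepE := truncn_itv Du0.
  have kD : (Num.truncn (D * u) < size (succs y))%N by rewrite truncn_lt_nat.
  exists (Num.truncn (D * u)) => //=; split; first by rewrite -natr1 in stepE; vlra.
  by rewrite -wz walk_fromS (walk_step_itv kD stepE).
move=> k /= kD [Du wz].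
have stepE : k%:R <= D * u < k.+1%:R by rewrite -natr1; vlra.
have kD' : k%:R + 1 <= D by rewrite natr1 ler_nat.
split; last by rewrite walk_fromS (walk_step_itv kD stepE).
have /andP[D1 D2] := stepE; apply/andP; split.
  by rewrite -(pmulr_rge0 _ d0) (le_trans _ D1).
by rewrite -(ltr_pM2l d0) mulr1 (lt_le_trans D2)// -natr1.
Qed.

Lemma uniform_prob_itv (a b : R) : 0 <= a -> a <= b -> b <= 1 ->
  uniform_prob (@ltr01 R) `[a, b[%classic = (b - a)%:E.
Proof.
move=> a0 ab b1; rewrite /uniform_prob integral_uniform_pdf setIidl; last first.
  by move=> u /=; rewrite !in_itv/=; lra.
rewrite (eq_integral (fun=> 1%:E)); last first.
  move=> u; rewrite inE/= in_itv/= /uniform_pdf => uab.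
  by rewrite ifT ?subr0 ?invr1//; lra.
rewrite integral_cst//= mul1e lebesgue_measure_itv/= lte_fin.
by case: ltP => // ba; rewrite (_ : b = a) ?subrr//; apply/eqP; rewrite eq_le ba.
Qed.

(** Recurrence quantifies over all realizations, so drawing a conclusion from it requires one to
    exist. *)
Lemma simple_random_walk_exists (y : V) :
  simple_random_walk T y (uniform_prob (@ltr01 R)) (unit_walk y).
Proof.
have m01 : measurable ([set u | 0 <= u < 1] : set R).
  by rewrite unit_itvE; exact: measurable_itv.
have mX n z : measurable (unit_walk y n @^-1` [set z] : set R).
  have -> : unit_walk y n @^-1` [set z] =
      [set u | 0 <= u < 1 /\ walk_from y n u = z] `|`
      (~` [set u | 0 <= u < 1] `&` [set u | y = z]).
    apply/seteqP; split => u /=; rewrite /unit_walk.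
      by case: ifPn => /= [u01 <-|/negP u01 <-]; [left|right].
    by move=> [[-> ->//]|[/negP/negbTE -> ->]].
  apply: measurableU; first exact: measurable_walk_from.
  apply: measurableI; first exact: measurableC.
  case: (pselect (y = z)) => yz.
    by rewrite (_ : [set _ | _] = setT)//; apply/seteqP; split.
  by rewrite (_ : [set _ | _] = set0)//; apply/seteqP; split.
split => // n p; have [a /= [a0 al hw]] := walk_cylinder n y p.
set l := _ * _ in al hw *.
have l0 : 0 <= l.
  by rewrite mulr_ge0// prodr_ge0// => i _; exact: srw_prob_ge0.
set E := [set u : R | _]; have mE : measurable E.
  rewrite (_ : E = \bigcap_(i in `I_n.+1) (unit_walk y i @^-1` [set p i])).
    by apply: fin_bigcap_measurable => // i _; exact: mX.
  by apply/seteqP; split => w h i; [move=> /h|exact: h].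
have P1 : uniform_prob (@ltr01 R) [set u : R | 0 <= u < 1] = 1%E.
  by rewrite unit_itvE uniform_prob_itv ?subr0.
have := @probability_setI_conull _ _ (uniform_prob (@ltr01 R)) _ _ mE m01 P1.
move=> /= <-.
rewrite (_ : E `&` _ = `[a, a + l[%classic).
  by rewrite /= uniform_prob_itv ?lerDl// addrAC subrr add0r.
apply/seteqP; split => u /=; rewrite in_itv/=.
  move=> [Eu u01]; apply/(hw u u01) => i im; have := Eu i im.
  by rewrite /unit_walk u01.
move=> ua; have u01 : 0 <= u < 1 by vlra.
by split => // i im; rewrite /unit_walk u01; apply: (hw u u01).2 i im.
Qed.

End Interval.

Lemma recurrent_cond_eq0 : srw_recurrent R T -> cond R T r = 0.
Proof.
move=> rec; apply/eqP; rewrite eq_le cond_ge0 andbT leNgt; apply/negP => cr.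
have [dl dl0 missd] := miss_transient cr.
have HX := simple_random_walk_exists r.
have [N [mN N0 nN]] := rec r _ _ _ _ HX.
have mn := measurable_never HX; have mc := measurable_cyl HX 0 (fun=> r).
have : (uniform_prob (@ltr01 R) (never r (unit_walk r)) = 0)%E.
  apply/eqP; rewrite -measure_le0 -N0 le_measure ?inE// => w nw; apply: nN => -[n n0].
  exact: nw.
rewrite /= -(@probability_setI_conull _ _ _ _ _ mn mc (prob_start HX)) => P0.
have := cvg_prob_never HX; rewrite P0 => c0; have cf : (fun n => miss r n r) @ \oo --> (0 : R).
  by have /fine_cvgP[_] := c0.
have : dl <= 0.
  rewrite -(cvg_lim (@Rhausdorff R) cf); apply: limr_ge; first exact: cvgP cf.
  exact: nearW.
by rewrite leNgt dl0.
Qed.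

End Walk.

(** * Bounded random variables and independence *)

Section Expectation.
Variables (R : realType) (d : measure_display) (Omega : measurableType d).
Variable P : probability Omega R.

Definition pr (A : set Omega) : R := fine (P A).
Definition Ex (X : Omega -> R) : R := Rintegral P setT X.

Lemma prE A : measurable A -> P A = (pr A)%:E.
Proof. by move=> mA; rewrite /pr fineK// fin_num_measure. Qed.

Lemma pr_eq0 A : P A = 0%E -> pr A = 0.
Proof. by rewrite /pr => ->. Qed.

Lemma pr_ge0 A : 0 <= pr A.
Proof. by rewrite /pr fine_ge0. Qed.

Lemma pr_le A B : measurable A -> measurable B -> A `<=` B -> pr A <= pr B.
Proof. by move=> mA mB AB; rewrite -lee_fin -!prE// le_measure ?inE. Qed.

Lemma prC A : measurable A -> pr (~` A) = 1 - pr A.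
Proof.
by move=> mA; rewrite /pr probability_setC// (prE mA) -EFinB.
Qed.

Lemma prU_le A B : measurable A -> measurable B -> pr (A `|` B) <= pr A + pr B.
Proof.
move=> mA mB; rewrite -lee_fin EFinD -!prE//; last exact: measurableU.
by rewrite measureU2.
Qed.

Definition bounded_rv (X : Omega -> R) : Prop :=
  measurable_fun setT X /\ exists M : R, forall w, `|X w| <= M.

Lemma bounded_rv_integrable X : bounded_rv X -> P.-integrable setT (EFin \o X).
Proof.
move=> [mX [M XM]]; apply: measurable_bounded_integrable => //.
  by rewrite (le_lt_trans (probability_le1 _ _))// ltry.
by exists M; split; [exact: num_real|move=> N MN w _; exact: le_trans (XM w) (ltW MN)].
Qed.

Lemma bounded_rv_pos (X : Omega -> R) (M : R) : measurable_fun setT X -> (forall w, 0 <= X w <= M) -> bounded_rv X.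
Proof.
by move=> mX XM; split => //; exists M => w; have /andP[X0 ?] := XM w; rewrite ger0_norm.
Qed.

Lemma bounded_rvD (X Y : Omega -> R) : bounded_rv X -> bounded_rv Y -> bounded_rv (fun w => X w + Y w).
Proof.
move=> [mX [M XM]] [mY [N YN]]; split; first exact: measurable_funD.
by exists (M + N) => w; rewrite (le_trans (ler_normD _ _))// lerD.
Qed.

Lemma bounded_rvZ (X : Omega -> R) (a : R) : bounded_rv X -> bounded_rv (fun w => a * X w).
Proof.
move=> [mX [M XM]]; split; first exact: measurable_funM.
by exists (`|a| * M) => w; rewrite normrM ler_wpM2l.
Qed.

Lemma bounded_rv_cst a : bounded_rv (fun=> a).
Proof. by split; [exact: measurable_cst|exists `|a|]. Qed.

Lemma bounded_rv_indic A : measurable A -> bounded_rv (\1_A).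
Proof.
move=> mA; apply: (@bounded_rv_pos _ 1); first exact: measurable_indic.
by move=> w; rewrite indicE ler0n lern1 leq_b1.
Qed.

Lemma bounded_rvM_indic X A : measurable A -> bounded_rv X -> bounded_rv (fun w => X w * \1_A w).
Proof.
move=> mA [mX [M XM]]; split; first by apply: measurable_funM => //; exact: measurable_indic.
exists M => w; rewrite normrM indicE (le_trans _ (XM w))//.
by rewrite ler_piMr// normr_nat lern1 leq_b1.
Qed.

Lemma bounded_rv_sum (I : Type) (s : seq I) (X : I -> Omega -> R) : (forall i, bounded_rv (X i)) ->
  bounded_rv (fun w => \sum_(i <- s) X i w).
Proof.
move=> bX; elim: s => [|i s IH].
  by under eq_fun do rewrite big_nil; exact: bounded_rv_cst.
by under eq_fun do rewrite big_cons; exact: bounded_rvD.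
Qed.

Lemma ExD (X Y : Omega -> R) : bounded_rv X -> bounded_rv Y -> Ex (fun w => X w + Y w) = Ex X + Ex Y.
Proof. by move=> /bounded_rv_integrable iX /bounded_rv_integrable iY; exact: RintegralD. Qed.

Lemma ExZ (X : Omega -> R) (a : R) : bounded_rv X -> Ex (fun w => a * X w) = a * Ex X.
Proof. by move=> /bounded_rv_integrable iX; exact: RintegralZl. Qed.

Lemma Ex_cst a : Ex (fun=> a) = a.
Proof. by rewrite /Ex Rintegral_cst//= probability_setT mulr1. Qed.

Lemma Ex_le (X Y : Omega -> R) : bounded_rv X -> bounded_rv Y -> (forall w, X w <= Y w) -> Ex X <= Ex Y.
Proof.
move=> /bounded_rv_integrable iX /bounded_rv_integrable iY XY.
by apply: le_Rintegral => // w _; exact: XY.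
Qed.

Lemma Ex_ge0 (X : Omega -> R) : (forall w, 0 <= X w) -> 0 <= Ex X.
Proof. by move=> X0; exact: Rintegral_ge0. Qed.

Lemma Ex_sum (I : Type) (s : seq I) (X : I -> Omega -> R) : (forall i, bounded_rv (X i)) ->
  Ex (fun w => \sum_(i <- s) X i w) = \sum_(i <- s) Ex (X i).
Proof.
move=> bX; elim: s => [|i s IH].
  by under eq_fun do rewrite big_nil; rewrite big_nil Ex_cst.
under eq_fun do rewrite big_cons; rewrite big_cons ExD ?IH//; exact: bounded_rv_sum.
Qed.

Lemma Ex_indic A : measurable A -> Ex \1_A = pr A.
Proof. by move=> mA; rewrite /Ex /Rintegral integral_indic// setIT. Qed.

Lemma markov_pr (X : Omega -> R) (a : R) : bounded_rv X -> (forall w, 0 <= X w) -> 0 <= a ->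
  a * pr [set w | a <= X w] <= Ex X.
Proof.
move=> bX X0 a0; have mA : measurable [set w | a <= X w].
  have [mX _] := bX; rewrite -[X in measurable X]setTI.
  have := measurable_fun_ler (@measurable_cst _ _ _ _ setT a) mX.
  by move=> /(_ measurableT [set true]); apply.
rewrite -Ex_indic// -ExZ; last exact: bounded_rv_indic.
apply: Ex_le => //; first exact/bounded_rvZ/bounded_rv_indic.
move=> w; rewrite indicE; case: (boolP (w \in _)) => [/[!inE]/=|_]; rewrite ?mulr1//.
by rewrite mulr0.
Qed.

Lemma measurable_set_lt (X Y : Omega -> R) : measurable_fun setT X ->
  measurable_fun setT Y -> measurable [set w | X w < Y w].
Proof.
move=> mX mY; rewrite -[X in measurable X]setTI.
by have := measurable_fun_ltr mX mY => /(_ measurableT [set true]); apply.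
Qed.

Lemma measurable_set_le (X Y : Omega -> R) : measurable_fun setT X ->
  measurable_fun setT Y -> measurable [set w | X w <= Y w].
Proof.
move=> mX mY; rewrite -[X in measurable X]setTI.
by have := measurable_fun_ler mX mY => /(_ measurableT [set true]); apply.
Qed.

End Expectation.

Section Independence.
Variables (R : realType) (d : measure_display) (Omega : measurableType d).
Variables (P : probability Omega R) (I : choiceType) (J : I -> {RV P >-> R}).

Definition cylinder_sets (S : set I) : set (set Omega) :=
  [set B | exists (s : {fset I}) (A : I -> set R),
    [/\ [set` s] `<=` S, forall i, measurable (A i) &
        B = \bigcap_(i in [set` s]) (J i @^-1` A i)]].

(* Measurability with respect to the sigma-algebra generated by the [J i], [i \in S]. *)
Definition determined_by (S : set I) (X : Omega -> R) : Prop :=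
  measurable_fun [set: g_sigma_algebraType (cylinder_sets S)]
    (X : g_sigma_algebraType (cylinder_sets S) -> R).

Lemma cylinder_measurable S : cylinder_sets S `<=` measurable.
Proof.
move=> B [s [A [sS mA ->]]]; apply: fin_bigcap_measurable; first exact: finite_fset.
by move=> i _; rewrite -[X in measurable X]setTI; exact: measurable_funP.
Qed.

Lemma cylinder_setI S : setI_closed (cylinder_sets S).
Proof.
move=> _ _ [s1 [A1 [sS1 mA1 ->]]] [s2 [A2 [sS2 mA2 ->]]].
exists (s1 `|` s2)%fset, (fun i => (if i \in s1 then A1 i else setT) `&`
  (if i \in s2 then A2 i else setT)); split.
- by move=> i /=; rewrite in_fsetU => /orP[/sS1|/sS2].
- by move=> i; apply: measurableI; case: ifP.
apply/seteqP; split => w /=.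
  by move=> [h1 h2] i /= _; split; case: ifP => // /[dup]; [move=> _; exact: h1|
    move=> _; exact: h2].
move=> h; split => i /= si.
  by have := h i; rewrite /= in_fsetU si /= => /(_ isT)[].
by have := h i; rewrite /= in_fsetU si orbT => /(_ isT)[].
Qed.

Lemma generated_measurable S B : <<s cylinder_sets S >> B -> measurable B.
Proof.
by move: B; apply: (smallest_sub (@sigma_algebra_measurable _ Omega));
  exact: cylinder_measurable.
Qed.

Lemma determined_measurable S X : determined_by S X -> measurable_fun setT X.
Proof.
by move=> mX _ B mB; rewrite setTI; apply: (@generated_measurable S); rewrite -[X in _ X]setTI; exact: mX.
Qed.

Lemma determined_J S i : S i -> determined_by S (J i).
Proof.
move=> Si _ B mB; rewrite setTI; apply: sub_sigma_algebra.
exists [fset i]%fset, (fun=> B); split => //.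
  by move=> j /=; rewrite inE => /eqP ->.
by apply/seteqP; split => w; [move=> h j /=; rewrite inE => /eqP ->|apply; rewrite /= inE].
Qed.

Variable nu : probability (measurableTypeR R) R.
Hypothesis hJ : iid_with_law nu J.

(** The measures [B |-> P (B /\ D)] and [B |-> P D * P B] agree on the cylinder sets, which are
    stable under intersection, hence on the sigma-algebra they generate. *)
Lemma indep_sets S e (A : set R) B : ~ S e -> measurable A -> <<s cylinder_sets S >> B ->
  P (J e @^-1` A `&` B) = (P (J e @^-1` A) * P B)%E.
Proof.
move=> Se mA; have mD : measurable (J e @^-1` A).
  by rewrite -[X in measurable X]setTI; exact: measurable_funP.
have p0 : 0 <= pr P (J e @^-1` A) by exact: pr_ge0.
pose m1 := mrestr P mD; pose m2 := mscale (NngNum p0) P.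
suff: forall B, <<s cylinder_sets S >> B -> m1 B = m2 B.
  by move=> h sB; rewrite setIC; have := h B sB; rewrite /m1 /mrestr /m2 /mscale/= -prE.
apply: (@g_sigma_algebra_measure_unique _ _ _ _ (@cylinder_measurable S) (fun=> setT)).
- move=> _; exists fset0, (fun=> setT); split => //.
  by apply/seteqP; split => // w _ i /=; rewrite inE.
- by apply/seteqP; split => // w _; exists 0%N.
- exact: cylinder_setI.
- move=> _ [s [C [sS mC ->]]]; set B0 := \bigcap_(i in _) _.
  change (P (B0 `&` J e @^-1` A) = ((pr P (J e @^-1` A))%:E * P B0)%E).
  rewrite -prE// setIC {}/B0.
  have [_ prodP] := hJ.
  have es : e \notin s by apply/negP => /sS.
  pose C' i := if i == e then A else C i.
  have C's i : i \in s -> C' i = C i.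
    by rewrite /C'; case: eqP => // -> es'; rewrite es' in es.
  rewrite [X in P X](_ : _ = \bigcap_(i in [set` e |` s]%fset) (J i @^-1` C' i)).
    rewrite prodP => [|i]; last by rewrite /C'; case: ifP.
    rewrite big_fsetU1//= {1}/C' eqxx; congr (_ * _)%E.
    by rewrite prodP//; apply: eq_big_seq => i /C's ->.
  apply/seteqP; split => w /=.
    move=> [Aw h] i /=; rewrite !inE => /orP[/eqP ->|si].
      by rewrite /preimage/= /C' eqxx.
    by rewrite /preimage/= C's//; exact: h.
  move=> h; split; first by have := h e; rewrite /= !inE eqxx /C' eqxx; apply.
  by move=> i /= si; have := h i; rewrite /= !inE si orbT C's//; apply.
- move=> _; change (P (setT `&` J e @^-1` A) < +oo)%E.
  by rewrite setTI (prE P mD) ltry.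
Qed.

(** By [indep_sets], [X] has the same law under [P] restricted to the event and under [P] scaled by
    its probability; the two integrals are compared on the image side. *)
Lemma indep_Ex S e (A : set R) (X : Omega -> R) : ~ S e -> measurable A -> determined_by S X ->
  bounded_rv X -> (forall w, 0 <= X w) ->
  Ex P (fun w => X w * \1_(J e @^-1` A) w) = pr P (J e @^-1` A) * Ex P X.
Proof.
move=> Se mA dX bX X0; have mD : measurable (J e @^-1` A).
  by rewrite -[X in measurable X]setTI; exact: measurable_funP.
have mX := determined_measurable dX.
set D := J e @^-1` A in mD *.
have p0 : 0 <= pr P D by exact: pr_ge0.
pose m1 := mrestr P mD; pose m2 := mscale (NngNum p0) P.
have push (m : {measure set Omega -> \bar R}) :
    (\int[m]_w (X w)%:E = \int[pushforward m X]_(x in (`[0%R, +oo[%classic : set R)) x%:E)%E.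
  rewrite (ge0_integral_pushforward mX)//=.
  - rewrite (_ : X @^-1` _ = setT)//; apply/seteqP; split => // w _ /=.
    by rewrite in_itv/= X0.
  - by move=> x; rewrite inE/= in_itv/= andbT lee_fin.
have e12 : (\int[m1]_w (X w)%:E = \int[m2]_w (X w)%:E)%E.
  rewrite !push; apply: eq_measure_integral => B mB _.
  change (P (X @^-1` B `&` D) = ((pr P D)%:E * P (X @^-1` B))%E).
  rewrite -prE// setIC.
  by apply: (indep_sets Se mA); rewrite -[X in _ X]setTI; exact: dX.
have mXE : measurable_fun setT (EFin \o X) by exact/measurable_EFinP.
have X0E w : (0 <= (X w)%:E)%E by rewrite lee_fin.
have eD : (\int[m1]_w (X w)%:E = \int[P]_(w in D) (X w)%:E)%E.
  rewrite -(setUv D) ge0_integral_setU//=; last 3 first.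
  - exact: measurableC.
  - by rewrite setUv.
  - by apply/disj_setPS => w [].
  rewrite [X in (_ + X)%E](_ : _ = 0%E) ?adde0.
    apply: eq_measure_integral => B mB BD.
    by change (P (B `&` D) = P B); rewrite setIidl.
  rewrite (eq_measure_integral mzero) ?integral_measure_zero// => B mB BD.
  change (P (B `&` D) = 0%E).
  by rewrite (_ : B `&` D = set0) ?measure0//; apply/seteqP; split => w // [/BD].
transitivity (Rintegral P D X).
  rewrite /Ex [RHS]Rintegral_mkcond; apply: eq_Rintegral => w _.
  by rewrite patchE indicE; case: ifP; rewrite ?mulr1 ?mulr0.
rewrite /Rintegral -eD e12 ge0_integral_mscale//= fineM//.
exact: (integrable_fin_num measurableT (bounded_rv_integrable P bX)).
Qed.

End Independence.

(** * Random capacities *)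

(** Uses [1 - s <= 1 / (1 + s)] with [s = b * x], then monotonicity of [y / (1 + b * y)]. *)
Lemma quadratic_le_saturation (R : realFieldType) (b x y : R) : 0 <= b -> 0 <= x ->
  x <= y -> x - b * x * x <= y / (1 + b * y).
Proof.
move=> b0 x0 xy; have bx : 0 <= b * x by exact: mulr_ge0.
have bxy : b * x <= b * y by exact: ler_wpM2l.
apply: (@le_trans _ _ (x / (1 + b * x))).
  rewrite ler_pdivlMr; last by rewrite ltr_pwDl.
  rewrite [leLHS](_ : _ = x - x * (b * x) ^+ 2); last by ring.
  by rewrite gerBl mulr_ge0// sqr_ge0.
rewrite ler_pdivrMr ?ltr_pwDl// mulrAC ler_pdivlMr ?ltr_pwDl//; last by lra.
by rewrite -subr_ge0 (_ : _ - _ = y - x) ?subr_ge0//; ring.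
Qed.

Section RandomCapacities.
Variables (R : realType) (V : choiceType) (T : rooted_tree V).
Variables (nu : probability (measurableTypeR R) R) (hnu : linear_growth nu).
Variables (d : measure_display) (Omega : measurableType d) (P : probability Omega R).
Variables (J : edge T -> {RV P >-> R}) (hJ : iid_with_law nu J).
Local Notation r := (tree_root T).
Local Notation children := (children T).
Local Notation cond := (cond R T).
Local Notation cond_n := (cond_n R T).
Local Notation pr := (pr P).
Local Notation Ex := (Ex P).

Definition capacity (w : Omega) : V -> R := on_vertex (fun e => `|J e w| : R).

Lemma capacity_ge0 w z : 0 <= capacity w z.
Proof. by apply: on_vertex_ge0 => e; exact: normr_ge0. Qed.

Lemma capacityE w e : capacity w (tgt e) = `|J e w|.
Proof. by rewrite /capacity on_vertexE. Qed.

(** The edges on which the flow out of [y] depends. The edge leading to [y] is excluded, which makes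
    its coupling independent of that flow. *)
Definition below (y : V) : set (edge T) := [set e | desc T y (tgt e) /\ tgt e <> y].

Lemma below_self e : ~ below (tgt e) e.
Proof. by move=> []. Qed.

Lemma below_children y z : z \in children y -> below z `<=` below y.
Proof.
move=> zy e [dz ez]; split; first exact: desc_children zy dz.
by move=> ey; have := desc_depth dz; rewrite ey (children_depth zy) ltnn.
Qed.

Lemma edge_below y e : tgt e \in children y -> below y e.
Proof.
move=> ey; split; first exact: desc_childrenr ey (desc_refl _ _).
by move=> te; have := children_depth ey; rewrite te; lia.
Qed.

Lemma determined_mono S S' (X : Omega -> R) : S `<=` S' -> determined_by J S X -> determined_by J S' X.
Proof.
move=> SS' dX _ B mB; rewrite setTI; have := dX measurableT B mB; rewrite setTI.
apply: sub_smallest2r; first exact: smallest_sigma_algebra.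
move=> C [s [A [sS mA ->]]]; exists s, A; split => //.
exact: subset_trans sS SS'.
Qed.

Lemma determined_capacity y z : z \in children y -> determined_by J (below y) (capacity ^~ z).
Proof.
move=> zy; have [zr _] := childrenP zy; have [e ez] := edge_toP zr.
rewrite (_ : (fun w => _) = (fun w => `|J e w|)); last first.
  by apply/funext => w; rewrite -ez capacityE.
apply: (measurableT_comp (@normr_measurable R setT)); apply: determined_J.
by apply: edge_below; rewrite ez.
Qed.

Lemma determined_sum S (s : seq V) (X : V -> Omega -> R) :
  (forall z, z \in s -> determined_by J S (X z)) ->
  determined_by J S (fun w => \sum_(z <- s) X z w).
Proof.
move=> dX; rewrite (_ : (fun w => _) =
    (fun w => \sum_(z <- s) (if z \in s then X z else cst 0) w)); last first.
  by apply/funext => w; apply: eq_big_seq => z ->.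
by apply: measurable_sum => z; case: ifP => [/dX//|_]; exact: measurable_cst.
Qed.

Lemma determined_cst S (a : R) : determined_by J S (fun=> a).
Proof. exact: measurable_cst. Qed.

Lemma determined_min S (X Y : Omega -> R) : determined_by J S X -> determined_by J S Y ->
  determined_by J S (fun w => Num.min (X w) (Y w)).
Proof. by move=> dX dY; exact: measurable_minr. Qed.

(** [None] leaves the capacities as they are, so that one measurability proof serves both
    versions. *)
Definition capped (a : option R) (w : Omega) (z : V) : R :=
  if a is Some b then Num.min (capacity w z) b else capacity w z.

Lemma determined_maxflow_n a n y :
  determined_by J (below y) (fun w => maxflow_n T (capped a w) n y).
Proof.
have dk x z : z \in children x -> determined_by J (below x) (capped a ^~ z).
  by move=> zx; case: a => [b|]; [apply: determined_min; [|exact: determined_cst]|];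
    exact: determined_capacity.
elim: n y => [|n IH] y; first by apply: determined_sum => z; exact: dk.
apply: determined_sum => z zy; apply: determined_min; first exact: dk.
exact: determined_mono (below_children zy) (IH z).
Qed.

Lemma cvg_determined S (X : nat -> Omega -> R) (Y : Omega -> R) :
  (forall n, determined_by J S (X n)) -> (forall w, X ^~ w @ \oo --> Y w) ->
  determined_by J S Y.
Proof. by move=> dX XY; apply: measurable_fun_cvg dX _ => w _; exact: XY. Qed.

Lemma capped_ge0 (a : option R) w z : (if a is Some b then 0 <= b else true) -> 0 <= capped a w z.
Proof. by case: a => [b|] b0; rewrite /capped ?le_min ?capacity_ge0. Qed.

Lemma determined_maxflow (a : option R) y : (if a is Some b then 0 <= b else true) ->
  determined_by J (below y) (fun w => maxflow T (capped a w) y).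
Proof.
move=> a0; apply: (@cvg_determined _ (fun n w => maxflow_n T (capped a w) n y)) => [n|w].
  exact: determined_maxflow_n.
by apply: cvg_maxflow_n => z; exact: capped_ge0.
Qed.

Lemma small_ball : exists c C e0 : R, [/\ 0 < c, 0 < C, 0 < e0 & forall e (t : R), 0 < t < e0 ->
  c * t <= pr [set w | `|J e w| < t] <= C * t].
Proof.
have [c [C [c0 cC [e0 /= e00 He]]]] := hnu; exists c, C, e0; split => //.
  exact: lt_trans cC.
move=> e t /andP[t0 te]; have [law _] := hJ.
have -> : [set w | `|J e w| < t] = J e @^-1` `]- t, t[%classic.
  by apply/seteqP; split => w /=; rewrite in_itv/= ltr_norml.
have := law e `]- t, t[%classic (measurable_itv _).
rewrite /distribution /pushforward /pr => ->.
have /He : ball (0 : R) e0 t by rewrite /ball/= sub0r normrN gtr0_norm.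
move=> /(_ t0); rewrite -[nu _]fineK; last exact: fin_num_measure.
by rewrite !lee_fin.
Qed.

Lemma measurable_J_lt e (t : R) : measurable [set w | `|J e w| < t].
Proof.
apply: measurable_set_lt; last exact: measurable_cst.
by apply: (measurableT_comp (@normr_measurable R setT)); exact: measurable_funP.
Qed.

Lemma J_neq0 e : pr [set w | J e w = 0] = 0.
Proof.
have [c [C [e0 [c0 C0 e00 sb]]]] := small_ball.
apply/eqP; rewrite eq_le pr_ge0 andbT; apply/ler_addgt0Pr => x x0; rewrite add0r.
have [t [t0 te tx]] : exists t, [/\ 0 < t, t < e0 & C * t <= x].
  exists (Num.min (e0 / 2) (x / C)); split.
  - by rewrite lt_min !divr_gt0.
  - by rewrite gt_min ltr_pdivrMr//; apply/orP; left; lra.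
  - by rewrite mulrC -ler_pdivlMr// ge_min lexx orbT.
have /andP[_ ub] := sb e t (introT andP (conj t0 te)).
apply: le_trans tx; apply: le_trans ub; apply: pr_le; last 1 first.
- by move=> w /= ->; rewrite normr0.
- by rewrite (_ : [set _ | _] = J e @^-1` [set 0]).
- exact: measurable_J_lt.
Qed.

(** * Expected capped flow bounded above by the conductance *)

Section Recurrent.
Variables (b c e0 : R).
Hypothesis e00 : 0 < e0.
Hypothesis lb : forall e (t : R), 0 < t < e0 -> c * t <= pr [set w | `|J e w| < t].
Hypothesis b0 : 0 < b.
Hypothesis bc : 2 * b <= c * Num.min (e0 / 2) (1 / 2).

(** Let [a1] be the mean of [X1 = min(X, 1)]. On the independent event [D] that [|J e| < t], replace
    [X1] by [t]: the mean becomes [a1 - pr D * (a1 - t)]. With [t <= a1 / 2] and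
    [pr D >= c * t >= 2 * b * a1], this is at most [a1 - b * a1^2]. *)
Lemma Ex_min_le (e : edge T) (X : Omega -> R) : determined_by J (below (tgt e)) X ->
  bounded_rv X -> (forall w, 0 <= X w) ->
  Ex (fun w => Num.min (capped (Some 1) w (tgt e)) (X w)) <= Ex X / (1 + b * Ex X).
Proof.
move=> dX bX X0; set a := Ex X; have a0 : 0 <= a by exact: Ex_ge0.
pose X1 w := Num.min (X w) 1; set a1 := Ex X1.
have dX1 : determined_by J (below (tgt e)) X1.
  by apply: determined_min dX _; exact: determined_cst.
have X10 w : 0 <= X1 w <= 1 by rewrite le_min X0 ler01 ge_min lexx orbT.
have bX1 : bounded_rv X1 by apply: (bounded_rv_pos (determined_measurable dX1)) => w; exact: X10.
have a10 : 0 <= a1 by apply: Ex_ge0 => w; have /andP[] := X10 w.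
have a1a : a1 <= a by apply: Ex_le => // w; rewrite ge_min lexx.
have a11 : a1 <= 1.
  rewrite -[leRHS](Ex_cst P 1); apply: Ex_le => // [|w]; first exact: bounded_rv_cst.
  by have /andP[] := X10 w.
set Y := fun w => _; have mY : bounded_rv Y.
  apply: (@bounded_rv_pos _ _ _ _ 1) => [|w].
    apply: measurable_minr; last exact: determined_measurable dX.
    rewrite (_ : (fun w => _) = (fun w => Num.min `|J e w| 1)); last first.
      by apply/funext => w; rewrite /capped capacityE.
    apply: measurable_minr; last exact: measurable_cst.
    by apply: (measurableT_comp (@normr_measurable R setT)); exact: measurable_funP.
  by rewrite /Y /= !le_min capacity_ge0 ler01 X0 /= !ge_min lexx orbT.
suff : Ex Y <= a1 - b * a1 * a1.
  by move=> /le_trans; apply; apply: quadratic_le_saturation; rewrite // ltW.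
case: (eqVneq a1 0) => [a1e|a1n].
  rewrite a1e mulr0 subr0 -a1e; apply: Ex_le => // w.
  by rewrite /Y /X1 /capped /= le_min !ge_min !lexx !orbT.
have a1p : 0 < a1 by rewrite lt0r a1n.
(* Since [a1 <= 1], the first entry of the minimum keeps [t] below [e0]; the second gives
   [t <= a1 / 2]. *)
pose t := a1 * Num.min (e0 / 2) (1 / 2).
set D := [set w | `|J e w| < t].
have m0 : 0 < Num.min (e0 / 2) (1 / 2) by rewrite lt_min !divr_gt0.
have m1 : Num.min (e0 / 2) (1 / 2) <= 1 / 2 by rewrite ge_min lexx orbT.
have m2 : Num.min (e0 / 2) (1 / 2) <= e0 / 2 by rewrite ge_min lexx.
have t0 : 0 < t by rewrite mulr_gt0.
have te : t < e0 by rewrite /t; nra.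
have ta : t <= a1 / 2 by rewrite /t; nra.
have pD := lb e (introT andP (conj t0 te)); rewrite -/D in pD.
have mD : measurable D by exact: measurable_J_lt.
have DE : D = J e @^-1` `]- t, t[%classic.
  by apply/seteqP; split => w /=; rewrite in_itv/= /D/= ltr_norml.
have indep : Ex (fun w => X1 w * \1_D w) = pr D * a1.
  rewrite DE; apply: (indep_Ex hJ (@below_self e) _ dX1) => //.
  by move=> w; have /andP[] := X10 w.
have : Ex Y <= Ex (fun w => (X1 w + (-1) * (X1 w * \1_D w)) + t * \1_D w).
  apply: Ex_le => // [|w].
    apply: bounded_rvD; last exact/bounded_rvZ/bounded_rv_indic.
    by apply: bounded_rvD => //; apply: bounded_rvZ; exact: bounded_rvM_indic.
  rewrite indicE /Y /X1 /capped capacityE; case: (boolP (w \in D)) => [/[!inE] wD|_].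
    by rewrite !mulr1 mulN1r subrr add0r !ge_min (ltW wD).
  by rewrite !mulr0 !addr0 le_min !ge_min !lexx !orbT.
rewrite ExD; last 2 first.
- by apply: bounded_rvD => //; apply: bounded_rvZ; exact: bounded_rvM_indic.
- exact/bounded_rvZ/bounded_rv_indic.
rewrite ExD//; last by apply: bounded_rvZ; exact: bounded_rvM_indic.
rewrite (ExZ P _ (bounded_rvM_indic mD bX1)) (ExZ P _ (bounded_rv_indic R mD)).
rewrite indep Ex_indic// -/a1 => /le_trans; apply.
have : 2 * b * a1 <= pr D.
  apply: le_trans pD; rewrite /t [c * _]mulrCA mulrC ler_wpM2l//.
by move: (pr D) (pr_ge0 P D) => p p0 bp; nra.
Qed.

Hypothesis b1 : b <= 1.

Lemma bounded_rv_maxflow_n1 n y : bounded_rv (fun w => maxflow_n T (capped (Some 1) w) n y).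
Proof.
apply: (@bounded_rv_pos _ _ _ _ (size (children y))%:R).
  exact: (determined_measurable (@determined_maxflow_n (Some 1) n y)).
move=> w; have k0 z : 0 <= capped (Some 1) w z by exact: capped_ge0.
rewrite maxflow_n_ge0//=; apply: (@le_trans _ _ (maxflow_n T (capped (Some 1) w) 0 y)).
  exact: (@maxflow_n_noninc _ _ T _ k0 y 0 n (leq0n n)).
rewrite -sum1_size natr_sum; apply: ler_sum => z _.
by rewrite /capped ge_min lexx orbT.
Qed.

(** The factor [b] turns the bound of [Ex_min_le] into the conductance recursion, since [b * (a / (1
    + b * a)) = unit_series (b * a)]; generation 0 uses [b <= 1]. *)
Lemma Ex_maxflow_n_le_cond n y :
  b * Ex (fun w => maxflow_n T (capped (Some 1) w) n y) <= cond_n n y.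
Proof.
elim: n y => [|n IH] y.
  have c_le : Ex (fun w => maxflow_n T (capped (Some 1) w) 0 y) <= (size (children y))%:R.
    rewrite -[leRHS](Ex_cst P); apply: Ex_le; [exact: bounded_rv_maxflow_n1|exact: bounded_rv_cst|move=> w].
    rewrite -sum1_size natr_sum; apply: ler_sum => z _.
    by rewrite /capped ge_min lexx orbT.
  apply: le_trans c_le; rewrite ler_piMl//; apply: Ex_ge0 => w.
  by apply: maxflow_n_ge0 => z; exact: capped_ge0.
pose X z w := maxflow_n T (capped (Some 1) w) n z.
have X0 z w : 0 <= X z w by apply: maxflow_n_ge0 => x; exact: capped_ge0.
(* [Ex_sum] asks for a bounded variable at every index, while measurability is at hand only for
   children; hence the default 0. *)
pose Y z : Omega -> R :=
  if z \in children y then fun w => Num.min (capped (Some 1) w z) (X z w) else cst 0.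
have bY z : bounded_rv (Y z).
  rewrite /Y; case: ifP => zy; last exact: bounded_rv_cst.
  apply: (@bounded_rv_pos _ _ _ _ 1).
    have dk := determined_min (determined_capacity zy) (@determined_cst (below y) 1).
    have dX := determined_mono (below_children zy) (@determined_maxflow_n (Some 1) n z).
    exact: (determined_measurable (determined_min dk dX)).
  move=> w; rewrite le_min X0 capped_ge0//= !ge_min.
  by rewrite lexx orbT.
rewrite (_ : (fun w => _) = (fun w => \sum_(z <- children y) Y z w)); last first.
  by apply/funext => w; apply: eq_big_seq => z zy; rewrite /Y zy.
rewrite Ex_sum// mulr_sumr big_seq [leRHS]big_seq; apply: ler_sum => z zy.
have [zr _] := childrenP zy; have [e ez] := edge_toP zr.
have := @Ex_min_le e (X z); rewrite ez /Y zy => /(_ (@determined_maxflow_n (Some 1) n z) (bounded_rv_maxflow_n1 n z) (X0 z)).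
have := IH z; rewrite -/(X z) -/(cond_n n z).
move: (Ex (X z)) (Ex_ge0 P (X0 z)) => a a0 IHa.
set m := Ex _ => le_m.
apply: (@le_trans _ _ (unit_series (b * a))).
  by rewrite /unit_series -mulrA ler_wpM2l// ltW.
by apply: unit_series_mono IHa; rewrite mulr_ge0// ltW.
Qed.

(** [b * Ex F] is below every [cond_n n r], so [Ex F = 0]; Markov's inequality at the levels
    [1 / (n + 1)] then exhausts the event. *)
Lemma maxflow1_null : cond r = 0 ->
  P.-negligible [set w | 0 < maxflow T (capped (Some 1) w) r].
Proof.
move=> cr; pose F w := maxflow T (capped (Some 1) w) r.
have k0 w z : 0 <= capped (Some 1) w z by exact: capped_ge0.
have F0 w : 0 <= F w by exact: maxflow_ge0.
have mF : measurable_fun setT F.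
  by apply: determined_measurable; apply: determined_maxflow; exact: ler01.
have bF : bounded_rv F.
  apply: (@bounded_rv_pos _ _ _ _ (size (children r))%:R mF) => w; rewrite F0/=.
  rewrite (le_trans (maxflow_le T (k0 w) 0 r))// -sum1_size natr_sum.
  by apply: ler_sum => z _; rewrite /capped ge_min lexx orbT.
have ExF : Ex F = 0.
  apply/eqP; rewrite eq_le Ex_ge0// andbT; apply/ler_addgt0Pr => x x0; rewrite add0r.
  have [|n nx] := @cond_lt R V T r (b * x); first by rewrite cr mulr_gt0.
  rewrite -(ler_pM2l b0) (le_trans _ (ltW nx))// (le_trans _ (Ex_maxflow_n_le_cond n r))//.
  rewrite ler_pM2l//; apply: Ex_le => // [|w]; first exact: bounded_rv_maxflow_n1.
  exact: maxflow_le.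
have mA n : measurable [set w | n.+1%:R^-1 <= F w].
  by apply: measurable_set_le => //; exact: measurable_cst.
have A0 n : P [set w | n.+1%:R^-1 <= F w] = 0%E.
  rewrite prE//; congr (_%:E); apply/eqP; rewrite eq_le pr_ge0 andbT.
  have n0 : 0 < n.+1%:R^-1 :> R by rewrite invr_gt0.
  by rewrite -(ler_pM2l n0) mulr0 -ExF; apply: markov_pr => //; exact: ltW.
rewrite (_ : [set w | _] = \bigcup_n [set w | n.+1%:R^-1 <= F w]).
  apply: negligible_bigcup => n; exists [set w | n.+1%:R^-1 <= F w].
  split => //.
  exact: A0.
apply/seteqP; split => w /=; last first.
  by move=> [n _ /= nF]; apply: lt_le_trans nF; rewrite invr_gt0.
move=> Fw; exists (Num.bound (F w)^-1) => //=.
rewrite -[leRHS]invrK lef_pV2 ?posrE ?invr_gt0//.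
by rewrite ltW// (lt_trans (archi_boundP _)) ?invr_ge0 ?ltr_nat// ltW.
Qed.

End Recurrent.

(** Carries the vanishing of the capped flow over to the original one. The point is that [min(., 1)]
    is subadditive on nonnegative sums. *)
Lemma maxflow_n_cap_ge (k : V -> R) n y : (forall z, 0 <= k z) ->
  Num.min (maxflow_n T k n y) 1 <= maxflow_n T (fun z => Num.min (k z) 1) n y.
Proof.
move=> k0; have sum_min (s : seq V) (f : V -> R) : (forall z, 0 <= f z) ->
    Num.min (\sum_(z <- s) f z) 1 <= \sum_(z <- s) Num.min (f z) 1.
  move=> f0; elim: s => [|z s IH]; first by rewrite !big_nil ge_min lexx.
  rewrite !big_cons; have := sumr_ge0 s (fun z _ => f0 z) (P := xpredT).
  move: (\sum_(_ <- s) f _) (\sum_(_ <- s) Num.min _ _) IH (f0 z) => a a' + fz a0.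
  by case: (leP a 1); case: (leP (f z) 1); case: (leP (f z + a) 1); lra.
elim: n y => [|n IH] y; first exact: sum_min.
rewrite /maxflow_n /=; apply: le_trans (sum_min _ _ _) _ => [z|].
  by rewrite le_min k0; exact: maxflow_n_ge0.
apply: ler_sum => z _; rewrite -!/(maxflow_n _ _ _ _).
have := IH z; rewrite !le_min !ge_min => /orP[h|h]; rewrite ?h ?lexx ?orbT//.
Qed.

Lemma cond_eq0_maxflow : cond r = 0 ->
  {ae P, forall w, maxflow T (capacity w) r = 0}.
Proof.
move=> cr; have [c [C [e0 [c0 C0 e00 sb]]]] := small_ball.
pose m : R := Num.min (e0 / 2) (1 / 2).
have m0 : 0 < m by rewrite lt_min !divr_gt0.
pose b := Num.min 1 (c * m / 2).
have b0 : 0 < b by rewrite lt_min ltr01 divr_gt0// mulr_gt0.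
have b1 : b <= 1 by rewrite ge_min lexx.
have bc : 2 * b <= c * m.
  have : b <= c * m / 2 by rewrite ge_min lexx orbT.
  by lra.
have lb e t : 0 < t < e0 -> c * t <= pr [set w | `|J e w| < t].
  by move=> /(sb e)/andP[].
have := maxflow1_null e00 lb b0 bc b1 cr; apply: negligibleS => w /= Fw.
have k0 z : 0 <= capped (Some 1) w z by exact: capped_ge0.
rewrite lt0r maxflow_ge0// andbT; apply/eqP => F1; apply: Fw.
apply/eqP; rewrite eq_le maxflow_ge0; last exact: capacity_ge0.
rewrite andbT leNgt; apply/negP => F0.
have [|n] := @maxflow_lt _ _ T _ k0 r (Num.min (maxflow T (capacity w) r) 1).
  by rewrite F1 lt_min F0 ltr01.
rewrite ltNge => /negP; apply; apply: le_trans (maxflow_n_cap_ge _ _ (capacity_ge0 w)).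
rewrite le_min !ge_min lexx orbT andbT.
by rewrite (maxflow_le T (capacity_ge0 w) n r).
Qed.

(** * Flow bounded below in probability by the conductance *)

Section Transient.
Variables (C e0 : R).
Hypothesis C0 : 0 < C.
Hypothesis ub : forall e (t : R), 0 < t < e0 -> pr [set w | `|J e w| < t] <= C * t.

Let X n y w := maxflow_n T (capacity w) n y.

Let mX n y : measurable_fun setT (X n y).
Proof. exact: (determined_measurable (@determined_maxflow_n None n y)). Qed.

Let X0 n y w : 0 <= X n y w.
Proof. by apply: maxflow_n_ge0; exact: capacity_ge0. Qed.

Let bX n y t : 0 <= t -> bounded_rv (fun w => Num.min (X n y w) t).
Proof.
move=> t0; apply: (@bounded_rv_pos _ _ _ _ t) => [|w].
  by apply: measurable_minr => //; exact: measurable_cst.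
by rewrite le_min X0 t0 ge_min lexx orbT.
Qed.

(* The share [t * unit_series (cond z) / cond y] of a flow of strength [t] sent through [z]
   is that of the unit current flow, whose energy is [1 / cond y]; this makes the
   bound reproduce itself from the children to the parent. *)
Lemma Ex_min_maxflow_n_ge n y (t : R) : 0 < cond y -> 0 <= t < e0 ->
  t - C * t ^+ 2 / cond y <= Ex (fun w => Num.min (X n y w) t).
Proof.
(* What the edge to [z] lets through, so that [X n x] is the sum of [W n z] over the children of
   [x]. *)
pose W n z w := if n is n'.+1 then Num.min (capacity w z) (X n' z w) else capacity w z.
have XE m x w : X m x w = \sum_(z <- children x) W m z w by case: m.
have W0 m z w : 0 <= W m z w.
  by case: m => [|m]; rewrite /W ?le_min ?X0 capacity_ge0.
have mcap z : measurable_fun setT (fun w => capacity w z).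
  case: (pselect (z = r)) => [->|zr]; last have zp := children_parent zr.
    rewrite /capacity (_ : (fun w => _) = cst 0); first exact: measurable_cst.
    by apply/funext => w; rewrite on_vertex_root.
  exact: (determined_measurable (determined_capacity zp)).
have mW m z : measurable_fun setT (W m z).
  by case: m => [|m]; [exact: mcap|apply: measurable_minr; [exact: mcap|exact: mX]].
have bW m z s : 0 <= s -> bounded_rv (fun w => Num.min (W m z w) s).
  move=> s0; apply: (@bounded_rv_pos _ _ _ _ s) => [|w].
    by apply: measurable_minr => //; exact: measurable_cst.
  by rewrite le_min W0 s0 ge_min lexx orbT.
have small z s : z <> r -> 0 <= s < e0 ->
    measurable [set w | capacity w z < s] /\ pr [set w | capacity w z < s] <= C * s.
  move=> zr /andP[s0 se]; have [e ez] := edge_toP zr.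
  have -> : [set w | capacity w z < s] = [set w | `|J e w| < s].
    by apply/seteqP; split => w /=; rewrite -ez capacityE.
  split; first exact: measurable_J_lt.
  move: s0; rewrite le_eqVlt => /predU1P[<-|s0]; last by apply: ub; rewrite s0.
  rewrite mulr0 (_ : [set _ | _] = set0) /pr ?measure0//.
  by apply/seteqP; split => w //=; rewrite normr_lt0.
(* From children to parent: by [condE] the shares [sz] add up to [s], and the errors
   [C * sz^2 / unit_series (cond z)] add up to [C * s^2 / cond x]. Children of conductance 0 get
   share 0. *)
have glue m x s : 0 < cond x -> 0 <= s -> (forall z s', z \in children x -> 0 < cond z ->
    s' = s * unit_series (cond z) / cond x ->
    s' - C * s' ^+ 2 / unit_series (cond z) <= Ex (fun w => Num.min (W m z w) s')) ->
    s - C * s ^+ 2 / cond x <= Ex (fun w => Num.min (X m x w) s).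
  move=> cx s0 hz; pose sz z := s * unit_series (cond z) / cond x.
  have sz0 z : 0 <= sz z.
    by rewrite divr_ge0 ?(ltW cx)// mulr_ge0// unit_series_ge0// cond_ge0.
  have sum_sz : \sum_(z <- children x) sz z = s.
    by rewrite -mulr_suml -mulr_sumr -condE mulfK// gt_eqF.
  apply: (@le_trans _ _ (\sum_(z <- children x) (sz z - C * s ^+ 2 / cond x ^+ 2 * unit_series (cond z)))).
    rewrite sumrB sum_sz -mulr_sumr -condE lerD2l lerN2.
    by rewrite le_eqVlt; apply/orP; left; apply/eqP; field; rewrite gt_eqF.
  apply: (@le_trans _ _ (\sum_(z <- children x) Ex (fun w => Num.min (W m z w) (sz z)))).
    rewrite big_seq [leRHS]big_seq; apply: ler_sum => z zx.
    case: (eqVneq (cond z) 0) => [cz|cz].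
      rewrite /sz cz /unit_series !mul0r !mulr0 !mul0r subr0; apply: Ex_ge0 => w.
      by rewrite le_min W0 lexx.
    have cz0 : 0 < cond z by rewrite lt0r cz cond_ge0.
    apply: le_trans (hz z _ zx cz0 erefl); rewrite -/(sz z) lerD2l lerN2.
    rewrite le_eqVlt; apply/orP; left; apply/eqP; rewrite /sz; field.
    by rewrite !gt_eqF// unit_series_gt0.
  rewrite -Ex_sum => [|z]; last exact: bW.
  apply: Ex_le => [||w]; [by apply: bounded_rv_sum => z; exact: bW|exact: bX|].
  rewrite le_min XE -[X in _ && (_ <= X)]sum_sz.
  by apply/andP; split; apply: ler_sum => z _; rewrite ge_min lexx ?orbT.
(* Inserting the edge above [z]: its capacity is below [s] with probability at most [C * s], and
   then at most [s] is lost. *)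
have cut m z s (B : Omega -> R) : z <> r -> 0 <= s < e0 -> bounded_rv B -> (forall w, B w <= s) ->
    (forall w, s <= capacity w z -> B w <= W m z w) ->
    Ex B - C * s ^+ 2 <= Ex (fun w => Num.min (W m z w) s).
  move=> zr s01 bB Bs BW; have [mD pD] := small z s zr s01; have /andP[s0 _] := s01.
  set D := [set w | _] in mD pD.
  apply: (@le_trans _ _ (Ex (fun w => B w + (- s) * \1_D w))).
    rewrite ExD//; last exact/bounded_rvZ/bounded_rv_indic.
    rewrite (ExZ P _ (bounded_rv_indic R mD)) Ex_indic// lerD2l mulNr lerN2 expr2.
    by rewrite mulrCA ler_wpM2l.
  apply: Ex_le => [||w]; [by apply: bounded_rvD => //; exact/bounded_rvZ/bounded_rv_indic|exact: bW|].
  rewrite indicE; case: (boolP (w \in D)) => [_|/negP wD].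
    by rewrite mulr1 (@le_trans _ _ 0)// ?subr_le0// le_min W0 s0.
  rewrite mulr0 addr0 le_min Bs andbT; apply: BW; rewrite leNgt; apply/negP => ws.
  by apply: wD; rewrite inE.
have share x z s : 0 < cond x -> z \in children x -> 0 <= s < e0 ->
    0 <= s * unit_series (cond z) / cond x < e0.
  move=> cx zx /andP[s0 se]; rewrite divr_ge0 ?(ltW cx)//=; last first.
    by rewrite mulr_ge0// unit_series_ge0// cond_ge0.
  rewrite (le_lt_trans _ se)// ler_pdivrMr// ler_wpM2l// [leRHS]condE.
  rewrite (bigD1_seq z) ?children_uniq//= lerDl sumr_ge0// => u _.
  by apply: unit_series_ge0; exact: cond_ge0.
elim: n y t => [|n IH] y t cy t01; have /andP[t0 _] := t01;
  apply: glue => // z s zy cz sE; have [zr _] := childrenP zy; have s01 := share y z t cy zy t01;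
  rewrite -sE in s01; have /andP[s0 _] := s01; have h0 := unit_series_gt0 cz.
  apply: le_trans (cut 0%N z s (fun=> s) zr s01 (bounded_rv_cst _ _) _ _) => //.
  rewrite Ex_cst lerD2l lerN2 ler_pdivlMr// ler_piMr ?mulr_ge0 ?sqr_ge0 ?(ltW C0)//.
  exact/unit_series_le1/cond_ge0.
apply: le_trans (cut n.+1 z s (fun w => Num.min (X n z w) s) zr s01 _ _ _) => [||w|w sw].
(* Resistances in series: [1 / cond z + 1 = 1 / unit_series (cond z)]. *)
- rewrite -[leLHS](_ : s - C * s ^+ 2 / cond z - C * s ^+ 2 = _) ?lerD2r; first exact: IH.
  by rewrite /unit_series; field; rewrite !gt_eqF// ltr_wpDr// ltW.
- exact: bX.
- by rewrite ge_min lexx orbT.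
- rewrite /W le_min [X in _ && X]ge_min lexx andbT (le_trans _ sw)//.
  by rewrite ge_min lexx orbT.
Qed.

(** On the event that [X n y < t / 2], [min(X n y, t)] falls short of [t] by at least [t / 2], while
    its mean falls short by at most [C * t^2 / cond y]. The events increase with [n] to the one for
    [maxflow]. *)
Lemma pr_maxflow_lt y (t : R) : 0 < cond y -> 0 < t < e0 ->
  pr [set w | maxflow T (capacity w) y < t / 2] <= 2 * C * t / cond y.
Proof.
move=> cy /andP[t0 te].
have mA n : measurable [set w | X n y w < t / 2].
  by apply: measurable_set_lt => //; exact: measurable_cst.
have prA n : pr [set w | X n y w < t / 2] <= 2 * C * t / cond y.
  have := Ex_min_maxflow_n_ge n cy (introT andP (conj (ltW t0) te)).
  have : Ex (fun w => Num.min (X n y w) t) <=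
      Ex (fun w => t + (- (t / 2)) * \1_[set w | X n y w < t / 2] w).
    apply: Ex_le => [||w]; first by apply: bX; exact: ltW.
      by apply: bounded_rvD; [exact: bounded_rv_cst|exact/bounded_rvZ/bounded_rv_indic].
    rewrite indicE; case: (boolP (w \in _)) => [/[!inE]/= wt|_].
      by rewrite mulr1 ge_min; apply/orP; left; lra.
    by rewrite mulr0 addr0 ge_min lexx orbT.
  rewrite ExD ?Ex_cst; [|exact: bounded_rv_cst|exact/bounded_rvZ/bounded_rv_indic].
  rewrite (ExZ P _ (bounded_rv_indic R (mA n))) Ex_indic// => h1 h2.
  have := le_trans h2 h1; rewrite lerD2l mulNr lerN2 => h.
  rewrite -(ler_pM2l (_ : 0 < t / 2)) ?divr_gt0//; apply: (le_trans h).
  rewrite le_eqVlt; apply/orP; left; apply/eqP; field; by rewrite gt_eqF.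
have k0 w := capacity_ge0 w.
have -> : [set w | maxflow T (capacity w) y < t / 2] = \bigcup_n [set w | X n y w < t / 2].
  apply/seteqP; split => w /=; first by move=> /(maxflow_lt (k0 w))[n]; exists n.
  by move=> [n _ /=]; apply: le_lt_trans; exact: maxflow_le.
have mU : measurable (\bigcup_n [set w | X n y w < t / 2]) by exact: bigcupT_measurable.
have nd : nondecreasing_seq (fun n => [set w | X n y w < t / 2]).
  move=> m n mn; apply/subsetPset => w /=; apply: le_lt_trans.
  exact: (@maxflow_n_noninc _ _ T _ (k0 w) y).
have := nondecreasing_cvg_mu mA mU nd (mu := P) => cv.
rewrite -lee_fin -prE// -(cvg_lim _ cv)//; apply: lime_le; first exact: cvgP cv.
by apply: nearW => n /=; rewrite prE// lee_fin.
Qed.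

End Transient.

End RandomCapacities.

(** * Almost sure statements *)

Section AlmostSure.
Variables (R : realType) (V : choiceType) (T : rooted_tree V).
Variables (nu : probability (measurableTypeR R) R) (hnu : linear_growth nu).
Variables (d : measure_display) (Omega : measurableType d) (P : probability Omega R).
Variables (J : edge T -> {RV P >-> R}) (hJ : iid_with_law nu J).
Local Notation r := (tree_root T).
Local Notation children := (children T).
Local Notation cond := (cond R T).
Local Notation pr := (pr P).
Local Notation capacity := (capacity J).

(** The vertex type is arbitrary; listing the vertices by generation turns a statement about all
    edges into a countable union. *)
Fixpoint level (n : nat) : seq V :=
  if n is n'.+1 then flatten [seq children y | y <- level n'] else [:: r].

Lemma mem_level z : z \in level (depth T z).
Proof.
move: z; apply: (tree_ind (T := T)) => [|z zr IH]; first by rewrite depth_root inE.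
rewrite (depth_parent zr) /=; apply/flatten_mapP; exists (parent T z) => //; exact: children_parent.
Qed.

Lemma ae_J_neq0 : {ae P, forall w, forall e, J e w <> 0}.
Proof.
have mJ0 e : measurable [set w | J e w = 0].
  by rewrite (_ : [set _ | _] = J e @^-1` [set 0]).
have N0 z : P.-negligible [set w | z <> r /\ capacity w z = 0].
  case: (pselect (z = r)) => [zr|zr]; last have [e ez] := edge_toP zr.
    by apply: negligibleS (negligible_set0 P) => w [].
  exists [set w | J e w = 0]; split => //.
    by rewrite prE//; congr (_%:E); exact: (J_neq0 hnu hJ e).
  by move=> w [_ /=]; rewrite -ez capacityE => /normr0_eq0.
have Ns (s : seq V) : P.-negligible [set w | exists2 z, z \in s & z <> r /\ capacity w z = 0].
  elim: s => [|z s IH].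
    by apply: negligibleS (negligible_set0 P) => w [].
  apply: negligibleS (negligibleU (N0 z) IH) => w [z' + h].
  by rewrite inE => /predU1P[zz|z's]; [left; rewrite -zz|right; exists z'].
apply: negligibleS (negligible_bigcup (fun n => Ns (level n))) => w /= nJ.
apply: contrapT => nU; apply: nJ => e Je; apply: nU.
exists (depth T (tgt e)) => //=; exists (tgt e); first exact: mem_level.
by have [_ ?] := child_edge e; rewrite capacityE Je normr0.
Qed.

Lemma cond_eq0_ground_states : cond r = 0 ->
  {ae P, forall w, ground_states (fun e => J e w) = natural_ground_states (fun e => J e w)}.
Proof.
move=> /(cond_eq0_maxflow hnu hJ); apply: filterS2 ae_J_neq0 => w J0 F0.
exact: ground_states_natural.
Qed.

Lemma maxflow_cond_eq0 : {ae P, forall w, maxflow T (capacity w) r = 0} -> cond r = 0.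
Proof.
move=> [N [mN N0 hN]]; apply/eqP; rewrite eq_le cond_ge0 andbT leNgt; apply/negP => cr.
have [c [C [e0 [c0 C0 e00 sb]]]] := small_ball hnu hJ.
have ub e t : 0 < t < e0 -> pr [set w | `|J e w| < t] <= C * t by move=> /(sb e)/andP[].
(* Chosen so that the flow is at least [t / 2] with probability at least 1/2. *)
pose t := Num.min (e0 / 2) (cond r / (4 * C)).
have t0 : 0 < t by rewrite lt_min !divr_gt0// mulr_gt0.
have te : t < e0 by rewrite gt_min; apply/orP; left; lra.
have tc : 2 * C * t / cond r <= 1 / 2.
  rewrite ler_pdivrMr//; have : t <= cond r / (4 * C) by rewrite ge_min lexx orbT.
  by rewrite ler_pdivlMr ?mulr_gt0//; lra.
have mF : measurable_fun setT (fun w => maxflow T (capacity w) r).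
  exact: (determined_measurable (@determined_maxflow _ _ _ _ _ _ J None r isT)).
have := pr_maxflow_lt C0 ub cr (introT andP (conj t0 te)).
set A := [set w | _] => pA.
have mA : measurable A by apply: measurable_set_lt => //; exact: measurable_cst.
have : pr (~` A) <= pr N.
  apply: pr_le => //; first exact: measurableC.
  move=> w /= nA; apply: hN => /= F0; apply: nA; rewrite /A /= F0 divr_gt0//.
by rewrite prC// (pr_eq0 N0); lra.
Qed.

(** The event [E] does not involve the coupling of [e1]: [F z1] and [F z2] see only edges strictly
    below [z1] and [z2]. It is therefore independent of the event [0 < |J e1| < t / 2], whose
    probability is positive by the lower bound on [nu], and on both together
    [unnatural_ground_state] applies. *)
Lemma ground_states_cond_eq0 :
  {ae P, forall w, ground_states (fun e => J e w) = natural_ground_states (fun e => J e w)} ->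
  cond r = 0.
Proof.
move=> [N [mN N0 hN]]; apply/eqP; rewrite eq_le cond_ge0 andbT leNgt; apply/negP => cr.
have [v [z1 [z2 [z1v z2v z12 c1 c2]]]] := cond_branching cr.
have [z1r _] := childrenP z1v; have [z2r _] := childrenP z2v.
have [e1 ez1] := edge_toP z1r; have [e2 ez2] := edge_toP z2r.
have [c [C [e0 [c0 C0 e00 sb]]]] := small_ball hnu hJ.
have ub e t : 0 < t < e0 -> pr [set w | `|J e w| < t] <= C * t by move=> /(sb e)/andP[].
(* Sum of the failure rates, per unit of [t], of the three conditions in [E]; [K * t <= 1 / 2]
   leaves [E] probability at least 1/2. *)
pose K := 2 * C / cond z1 + 2 * C / cond z2 + C.
have K0 : 0 < K by rewrite !addr_gt0// divr_gt0// mulr_gt0.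
pose t := Num.min (e0 / 2) ((2 * K)^-1).
have t0 : 0 < t by rewrite lt_min divr_gt0//= invr_gt0 mulr_gt0.
have te : t < e0 by rewrite gt_min; apply/orP; left; lra.
have tK : K * t <= 1 / 2.
  have : t <= (2 * K)^-1 by rewrite ge_min lexx orbT.
  by rewrite -(ler_pM2l K0) invfM mulrCA mulfV ?gt_eqF//; lra.
pose F z w := maxflow T (capacity w) z.
pose S : set (edge T) := [set e | e <> e1].
have dF1 : determined_by J S (F z1).
  apply: determined_mono (@determined_maxflow _ _ _ _ _ _ J None z1 isT).
  by move=> e [_ ez] ee; apply: ez; rewrite ee.
have dF2 : determined_by J S (F z2).
  apply: determined_mono (@determined_maxflow _ _ _ _ _ _ J None z2 isT).
  move=> e [dz ez] ee; apply: z12; apply: (desc_children_uniq z1v z2v (desc_refl _ _)).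
  by rewrite -ez1 -ee.
have dJ2 : determined_by J S (fun w => `|J e2 w|).
  apply: (measurableT_comp (@normr_measurable R setT)); apply: determined_J.
  by move=> ee; apply: z12; rewrite -ez1 -ez2 ee.
pose G X := [set w | t / 2 <= X w] : set Omega.
have dG X : determined_by J S X -> <<s cylinder_sets J S >> (G X).
  move=> dX; apply: (@measurable_set_le _ _ (g_sigma_algebraType (cylinder_sets J S))).
    exact: measurable_cst.
  exact: dX.
have mG X : determined_by J S X -> measurable (G X) by move=> /dG; exact: generated_measurable.
have GE X : G X = ~` [set w | X w < t / 2].
  by apply/seteqP; split => w; rewrite /G /=; [move=> h; apply/negP; rewrite -leNgt|
    move=> /negP; rewrite -leNgt].
pose E := G (F z1) `&` G (F z2) `&` G (fun w => `|J e2 w|).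
have dE : <<s cylinder_sets J S >> E.
  apply: (@measurableI _ (g_sigma_algebraType (cylinder_sets J S))); last exact: dG.
  by apply: (@measurableI _ (g_sigma_algebraType (cylinder_sets J S))); exact: dG.
have mE : measurable E by exact: generated_measurable dE.
have t01 : 0 < t < e0 by rewrite t0.
have t02 : 0 < t / 2 < e0 by rewrite divr_gt0//=; lra.
have pE : 1 / 2 <= pr E.
  have mlt (X : Omega -> R) : measurable_fun setT X -> measurable [set w | X w < t / 2].
    by move=> mX; apply: measurable_set_lt => //; exact: measurable_cst.
  have mX1 := mlt _ (determined_measurable dF1).
  have mX2 := mlt _ (determined_measurable dF2).
  have mX3 := mlt _ (determined_measurable dJ2).
  have p1 := pr_maxflow_lt C0 ub c1 t01.
  have p2 := pr_maxflow_lt C0 ub c2 t01.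
  have p3 : pr [set w | `|J e2 w| < t / 2] <= C * t.
    by apply: (le_trans (ub e2 _ t02)); rewrite ler_pM2l//; lra.
  have -> : E = ~` ([set w | F z1 w < t / 2] `|` [set w | F z2 w < t / 2] `|`
      [set w | `|J e2 w| < t / 2]).
    by rewrite /E !GE !setCU.
  rewrite prC; last by apply: measurableU => //; exact: measurableU.
  have := prU_le P (measurableU _ _ mX1 mX2) mX3.
  have := prU_le P mX1 mX2.
  have : 2 * C * t / cond z1 + 2 * C * t / cond z2 + C * t <= 1 / 2.
    by apply: le_trans tK; rewrite /K !mulrDl ![_ / _ * t]mulrAC.
  by rewrite -/(F z1) -/(F z2) in p1 p2 *; lra.
(* The value 0 is removed because the flipped edge must be strictly unsatisfied. *)
pose A : set R := `]- (t / 2), t / 2[%classic `\ 0.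
have mA : measurable A by apply: measurableD => //; exact: measurable_itv.
have mJA : measurable (J e1 @^-1` A).
  by rewrite -[X in measurable X]setTI; exact: measurable_funP.
have pA : 0 < pr (J e1 @^-1` A).
  have mJ0 : measurable [set w | J e1 w = 0].
    by rewrite (_ : [set _ | _] = J e1 @^-1` [set 0]).
  have /andP[lb _] := sb e1 _ t02.
  have : pr [set w | `|J e1 w| < t / 2] <= pr (J e1 @^-1` A `|` [set w | J e1 w = 0]).
    apply: pr_le; [exact: measurable_J_lt|exact: measurableU|].
    move=> w /= Jw; case: (pselect (J e1 w = 0)) => J0; [by right|left].
    by split => //=; rewrite in_itv/= -ltr_norml.
  have := prU_le P mJA mJ0; rewrite (J_neq0 hnu hJ) addr0.
  have : 0 < c * (t / 2) by rewrite mulr_gt0// divr_gt0.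
  by lra.
have : P (J e1 @^-1` A `&` E) = 0%E.
  apply/eqP; rewrite -measure_le0 -N0 le_measure ?inE//; first exact: measurableI.
  move=> w [[/= Jw J0] [[/= F1 F2] J2]]; apply: hN => /=.
  rewrite in_itv/= -ltr_norml in Jw.
  have k1 : capacity w z1 = `|J e1 w| by rewrite -ez1 capacityE.
  have k2 : capacity w z2 = `|J e2 w| by rewrite -ez2 capacityE.
  apply: (unnatural_ground_state z1v z2v z12); rewrite -/(capacity w).
  - by rewrite k1 normr_gt0; exact/eqP.
  - by rewrite k1 (le_trans (ltW Jw)).
  - by rewrite k1 (le_trans (ltW Jw)).
  - by rewrite k1 k2 (le_trans (ltW Jw)).
rewrite (indep_sets hJ _ mA dE) => [|/(_ erefl)//].
rewrite (prE P mJA) (prE P mE) -EFinM => -[/eqP]; rewrite mulf_eq0 gt_eqF//= gt_eqF//.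
by apply: lt_le_trans pE; lra.
Qed.

End AlmostSure.

Theorem theorem2p1 (R : realType) (V : choiceType) (T : rooted_tree V)
    (nu : probability (measurableTypeR R) R) (hnu : linear_growth nu)
    (d : measure_display) (Omega : measurableType d) (P : probability Omega R)
    (J : edge T -> {RV P >-> R}) (hJ : iid_with_law nu J) :
  [<-> {ae P, forall w,
         ground_states (fun e => J e w) = natural_ground_states (fun e => J e w)};
       {ae P, forall w,
         ereal_inf (cutset_weights (fun e => `|J e w|)) = 0%E};
       {ae P, forall w, is_MaxFlow (fun e => `|J e w|) 0};
       srw_recurrent R T].
Proof.
have J0 w (e : edge T) : 0 <= `|J e w| by exact: normr_ge0.
tfae.
- move=> /(ground_states_cond_eq0 hnu hJ)/(cond_eq0_maxflow hnu hJ); apply: filterS => w Fw.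
  exact/inf_cutset_weights_eq0.
- apply: filterS => w /(inf_cutset_weights_eq0 (J0 w)) Fw.
  by apply/is_MaxFlow_maxflow.
- move=> h; apply: cond_eq0_recurrent; apply: (maxflow_cond_eq0 hnu hJ).
  by apply: filterS h => w /(is_MaxFlow_maxflow _ (J0 w)).
- by move=> /recurrent_cond_eq0; exact: (cond_eq0_ground_states hnu hJ).
Qed.
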